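(* Let $r\ge 0$ be an integer and $\delta\in\mathbb{C}$. Then all supersymmetric polynomials in the normalised Jucys-Murphy elements are central in the partition algebra $\mathcal{A}_r(\delta)$; that is, $$SS_r[N_1,\dots,N_r]\subseteq Z(\mathcal{A}_r(\delta)).$$
   Context: Partition algebra. All algebras are over $\mathbb{C}$. For $k\ge 1$ and $\delta\in\mathbb{C}$, $\mathcal{A}_{2k}(\delta)$ is the unital associative algebra with basis the set partitions of $\{1,\dots,k\}\cup\{1',\dots,k'\}$ (drawn as diagrams with top row $1,\dots,k$ and bottom row $1',\dots,k'$, blocks being connected components), with product $\pi\gamma=\delta^{n(\pi,\gamma)}\,\pi\circ\gamma$, where $\pi\circ\gamma$ is obtained by placing $\pi$ on top of $\gamma$, identifying the bottom vertices of $\pi$ with the top vertices of $\gamma$, deleting the components lying entirely in the middle row ($n(\pi,\gamma)$ is their number), and reading off the induced partition of the outer rows. The identity is $\{\{m,m'\}:1\le m\le k\}$. Set $\mathcal{A}_0(\delta)=\mathbb{C}$. $\mathcal{A}_{2k-1}(\delta)\subset\mathcal{A}_{2k}(\delta)$ is the span of the partitions in which $k,k'$ lie in the same block, and $\mathcal{A}_{2k-2}(\delta)$ is identified with the span of the partitions having $\{k,k'\}$ as a block, giving a chain $\mathcal{A}_0(\delta)\subset\mathcal{A}_1(\delta)\subset\cdots\subset\mathcal{A}_{2k}(\delta)$. Diagrams (unlisted vertices $m,m'$ form blocks $\{m,m'\}$): $s_i$ has blocks $\{i,(i+1)'\},\{i+1,i'\}$; $e_{2j-1}$ has blocks $\{j\},\{j'\}$;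 $e_{2i}$ has block $\{i,i+1,i',(i+1)'\}$ ($1\le i\le k-1$, $1\le j\le k$). Jucys-Murphy elements. $L_1=0$, $L_2=e_1$, $\sigma_2=1$, $\sigma_3=s_1$. For $i\ge1$, $L_{2i+2}=s_iL_{2i}s_i-s_iL_{2i}e_{2i}-e_{2i}L_{2i}s_i+e_{2i}L_{2i}e_{2i+1}e_{2i}+\sigma_{2i+1}$ and $L_{2i+1}=s_iL_{2i-1}s_i-L_{2i}e_{2i}-e_{2i}L_{2i}+(\delta-L_{2i-1})e_{2i}+\sigma_{2i}$, where for $i\ge2$, $\sigma_{2i+1}=s_{i-1}s_i\sigma_{2i-1}s_is_{i-1}+s_ie_{2i-2}L_{2i-2}s_ie_{2i-2}s_i+e_{2i-2}L_{2i-2}s_ie_{2i-2}-s_ie_{2i-2}L_{2i-2}s_{i-1}e_{2i}e_{2i-1}e_{2i-2}-e_{2i-2}e_{2i-1}e_{2i}s_{i-1}L_{2i-2}e_{2i-2}s_i$, $\sigma_{2i}=s_{i-1}s_i\sigma_{2i-2}s_is_{i-1}+e_{2i-2}L_{2i-2}s_ie_{2i-2}s_i+s_ie_{2i-2}L_{2i-2}s_ie_{2i-2}-e_{2i-2}L_{2i-2}s_{i-1}e_{2i}e_{2i-1}e_{2i-2}-s_ie_{2i-2}e_{2i-1}e_{2i}s_{i-1}L_{2i-2}e_{2i-2}s_i$. One has $L_i\in\mathcal{A}_i(\delta)$, $\sigma_i\in\mathcal{A}_{i+1}(\delta)$, and the $L_i$ pairwise commute. The normalised Jucys-Murphy elements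 are $N_i=L_i-\delta/2$. Supersymmetric polynomials. $p\in\mathbb{C}[x_1,\dots,x_r]$ is supersymmetric if (1) it is symmetric in the odd-indexed variables and symmetric in the even-indexed variables, and (2) substituting $x_1=-x_2=y$ yields a polynomial in $x_3,\dots,x_r$ independent of $y$. $SS_r[x]$ is the algebra of supersymmetric polynomials ($SS_0[x]=\mathbb{C}$, $SS_1[x]=\mathbb{C}[x_1]$), and $SS_r[N_1,\dots,N_r]\subseteq\mathcal{A}_r(\delta)$ is its image under the algebra homomorphism $x_i\mapsto N_i$. $Z(A)$ denotes the center of $A$. *)

(* Defs.v *)
From HB Require Import structures.
From mathcomp Require Import all_boot all_order all_fingroup all_algebra all_field.

Set Implicit Arguments.
Unset Strict Implicit.
Unset Printing Implicit Defensive.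

Import GRing.Theory.
Local Open Scope ring_scope.

(* The set partitions of the vertices 1, ..., k (top row, [inl]) and 1', ..., k'
   (bottom row, [inr]); the ordinal m : 'I_k stands for the vertex m + 1. *)
Definition vertex (k : nat) : Type := ('I_k + 'I_k)%type.
HB.instance Definition _ k := Finite.on (vertex k).

Definition diagram (k : nat) : Type :=
  {P : {set {set vertex k}} | partition P [set: vertex k]}.
HB.instance Definition _ k := Finite.on (diagram k).

Definition same_block k (d : diagram k) (u v : vertex k) : bool :=
  v \in pblock (val d) u.

(* The diagram whose blocks are the nonempty fibres of a labelling. *)
Definition fibres k (T : eqType) (f : vertex k -> T) : diagram k :=
  exist _ (preim_partition f [set: vertex k]) (preim_partitionP f _).

Section Stack.
Variable k : nat.
Implicit Types a b c d : diagram k.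

(* [a] drawn on top of [b]: three rows, where the middle one is at once the
   bottom row of [a] and the top row of [b]. *)
Definition stack : Type := ('I_k + 'I_k + 'I_k)%type.
HB.instance Definition _ := Finite.on stack.

Definition top (m : 'I_k) : stack := inl (inl m).
Definition mid (m : 'I_k) : stack := inl (inr m).
Definition bot (m : 'I_k) : stack := inr m.

Definition upper (v : vertex k) : stack :=
  match v with inl m => top m | inr m => mid m end.
Definition lower (v : vertex k) : stack :=
  match v with inl m => mid m | inr m => bot m end.
Definition outer (v : vertex k) : stack :=
  match v with inl m => top m | inr m => bot m end.

Definition glue a b : rel stack := fun x y =>
  [exists u, exists v,
     [&& x == upper u, y == upper v & same_block a u v]
  || [&& x == lower u, y == lower v & same_block b u v]].

Definition component a b (x : stack) : {set stack} :=
  [set y | connect (glue a b) x y].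

End Stack.

HB.lock Definition comp k (a b : diagram k) : diagram k :=
  fibres (fun v => component a b (outer v)).

Definition inner_components k (a b : diagram k) : {set {set stack k}} :=
  [set C in [set component a b x | x : stack k] | C \subset [set mid m | m : 'I_k]].

HB.lock Definition loops k (a b : diagram k) : nat := #|inner_components a b|.

Definition vnum k (m : 'I_k) : nat := m.+1.

Section Composition.
Variable k : nat.
Implicit Types a b c d : diagram k.

Definition did : diagram k :=
  fibres (fun v => match v with inl m => vnum m | inr m => vnum m end).

Definition colour (f g : {ffun 'I_k -> bool}) (v : vertex k) : bool :=
  match v with inl m => f m | inr m => g m end.

Definition compat d (f g : {ffun 'I_k -> bool}) : bool :=
  [forall u, forall v, same_block d u v ==> (colour f g u == colour f g v)].

Definition scolour (f h g : {ffun 'I_k -> bool}) (x : stack k) : bool :=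
  match x with inl (inl m) => f m | inl (inr m) => h m | inr m => g m end.

Lemma same_blockE d :
  [/\ reflexive (same_block d), symmetric (same_block d)
    & transitive (same_block d)].
Proof.
case: d => P dP; have [/eqP covP tiP _] := and3P dP.
have cP x : x \in cover P by rewrite covP inE.
rewrite /same_block /=; split=> [x|x y|y x z] /=.
- by rewrite mem_pblock.
- by rewrite -!eq_pblock // eq_sym.
- by rewrite -!eq_pblock // => /eqP-> /eqP->.
Qed.

Lemma fibresE (T : eqType) (f : vertex k -> T) u v :
  same_block (fibres f) u v = (f u == f v).
Proof.
rewrite /same_block /= /preim_partition pblock_equivalence_partition ?inE //.
by split=> // /eqP->.
Qed.

Lemma diagramP d d' : same_block d =2 same_block d' -> d = d'.
Proof.
move=> eqd; apply: val_inj.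
rewrite -[LHS](equivalence_partition_pblock (valP d)).
rewrite -[RHS](equivalence_partition_pblock (valP d')).
by apply: eq_imset => u; apply/setP=> v; rewrite !inE; apply: eqd.
Qed.

Lemma compE a b u v :
  same_block (comp a b) u v = (component a b (outer u) == component a b (outer v)).
Proof. by rewrite comp.unlock fibresE. Qed.

Lemma compat_inj d d' : compat d =2 compat d' -> d = d'.
Proof.
suff sub e e' : compat e =2 compat e' ->
    forall u v, same_block e u v -> same_block e' u v.
  move=> H; apply: diagramP => u v; apply/idP/idP; exact: sub.
move=> H u v euv; have [re' se' te'] := same_blockE e'.
pose f := [ffun m : 'I_k => same_block e' u (inl m)].
pose g := [ffun m : 'I_k => same_block e' u (inr m)].
have cE w : colour f g w = same_block e' u w by case: w => m /=; rewrite ffunE.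
have: compat e' f g.
  apply/forallP=> x; apply/forallP=> y; apply/implyP=> xy; rewrite !cE.
  apply/eqP; apply/idP/idP=> ux; first exact: te' xy.
  by apply: te' ux _; rewrite se'.
rewrite -H => /forallP/(_ u)/forallP/(_ v)/implyP/(_ euv).
by rewrite !cE re' => /eqP<-.
Qed.

Lemma compat_cst d x : compat d [ffun=> x] [ffun=> x].
Proof.
apply/forallP=> u; apply/forallP=> v; apply/implyP=> _.
by case: u v => [?|?] [?|?] /=; rewrite !ffunE.
Qed.

Lemma connect_glue_sym a b : connect_sym (glue a b).
Proof.
apply: sym_connect_sym => x y.
have [[_ sa _] [_ sb _]] := (same_blockE a, same_blockE b).
suff sub x' y' : glue a b x' y' -> glue a b y' x' by apply/idP/idP; apply: sub.
move=> /existsP[u /existsP[v uv]]; apply/existsP; exists v.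
apply/existsP; exists u; move: uv; rewrite sa sb.
by case/orP=> /and3P[-> -> ->]; rewrite ?orbT.
Qed.

Lemma componentE a b x y :
  (component a b x == component a b y) = connect (glue a b) x y.
Proof.
have sy := connect_glue_sym a b.
apply/eqP/idP=> [/setP/(_ y)|xy]; first by rewrite !inE connect0.
by apply/setP=> z; rewrite !inE (same_connect sy xy).
Qed.

Lemma component_refl a b x : x \in component a b x.
Proof. by rewrite inE connect0. Qed.

Lemma scolour_upper f h g v : scolour f h g (upper v) = colour f h v.
Proof. by case: v. Qed.
Lemma scolour_lower f h g v : scolour f h g (lower v) = colour h g v.
Proof. by case: v. Qed.
Lemma scolour_outer f h g v : scolour f h g (outer v) = colour f g v.
Proof. by case: v. Qed.

Lemma compat_glueP a b f h g :
  reflect (forall x y, connect (glue a b) x y -> scolour f h g x = scolour f h g y)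
          (compat a f h && compat b h g).
Proof.
apply: (iffP andP) => [[ca cb] x y|H]; last first.
  split; apply/forallP=> u; apply/forallP=> v; apply/implyP=> uv.
    rewrite -!(scolour_upper f h g); apply/eqP/H/connect1.
    by apply/existsP; exists u; apply/existsP; exists v; rewrite !eqxx uv.
  rewrite -!(scolour_lower f h g); apply/eqP/H/connect1.
  by apply/existsP; exists u; apply/existsP; exists v; rewrite !eqxx uv orbT.
case/connectP=> p; elim: p x => [|z p IH] x /=; first by move=> _ ->.
case/andP=> xz zp ey; rewrite -(IH _ zp ey).
case/existsP: xz => u /existsP[v /orP[]/and3P[/eqP-> /eqP-> uv]].
  rewrite !scolour_upper; apply/eqP.
  by move/forallP/(_ u)/forallP/(_ v)/implyP/(_ uv): ca.
rewrite !scolour_lower; apply/eqP.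
by move/forallP/(_ u)/forallP/(_ v)/implyP/(_ uv): cb.
Qed.

(* The number of colourings of the middle row compatible with [a] and [b] is
   either 0 or [2 ^ loops a b]; associativity is deduced from this count. *)
Lemma count_colours a b f g :
  (\sum_h compat a f h * compat b h g = 2 ^ loops a b * compat (comp a b) f g)%N.
Proof.
under eq_bigr => h _ do rewrite mulnb.
rewrite -big_mkcond sum1dep_card.
have [cfg|ncfg] := boolP (compat (comp a b) f g); last first.
  rewrite muln0; apply/eqP; rewrite cards_eq0 -subset0; apply/subsetP=> h.
  rewrite !inE => /compat_glueP H; apply: contraNT ncfg => _.
  apply/forallP=> u; apply/forallP=> v; apply/implyP; rewrite compE componentE.
  by move=> /H; rewrite !scolour_outer => ->.
rewrite muln1 loops.unlock -card_powerset.
pose CC := component a b; pose K := inner_components a b.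
have outK v : CC (outer v) \notin K.
  rewrite inE negb_and; apply/orP; right; apply/negP=> /subsetP.
  by move=> /(_ _ (component_refl a b _)) /imsetP[m _]; case: v.
have inK x : (forall v, outer v \notin CC x) -> CC x \in K.
  move=> H; rewrite inE imset_f //=; apply/subsetP=> -[[m|m]|m] mx.
  - by move: (H (inl m)); rewrite mx.
  - exact: imset_f.
  - by move: (H (inr m)); rewrite mx.
have CCE x y : y \in CC x -> CC y = CC x.
  by rewrite inE -componentE => /eqP.
pose col (A : {set {set stack k}}) (x : stack k) : bool :=
  (CC x \in A) || [exists v, (outer v \in CC x) && colour f g v].
pose H A : {ffun 'I_k -> bool} := [ffun m => col A (mid m)].
have colE (A : {set {set stack k}}) x : A \subset K -> scolour f (H A) g x = col A x.
  move=> /subsetP AK.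
  suff cout v : colour f g v = col A (outer v).
    case: x => [[m|m]|m]; last exact: (cout (inr m)); first exact: (cout (inl m)).
    by rewrite /= ffunE.
  have -> : col A (outer v) = [exists w, (outer w \in CC (outer v)) && colour f g w].
    by rewrite /col; case: (boolP (_ \in A)) => // /AK; rewrite (negbTE (outK v)).
  apply/idP/existsP=> [cv|[w /andP[vw cw]]]; first by exists v; rewrite component_refl.
  move/forallP/(_ w)/forallP/(_ v)/implyP: cfg; rewrite compE.
  by rewrite -/(CC _) -/(CC (outer v)) (CCE _ _ vw) eqxx => /(_ isT)/eqP <-.
rewrite -(card_in_imset (f := H) (D := mem (powerset K))); last first.
  move=> A B; rewrite !inE => AK BK eqH.
  suff sub (A' B' : {set {set stack k}}) : A' \subset K -> B' \subset K -> H A' = H B' -> A' \subset B'.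
    by apply/eqP; rewrite eqEsubset; apply/andP; split; exact: sub.
  move=> /[dup] sA /subsetP AK' BK' eqH'; apply/subsetP=> C CA.
  have := AK' _ CA; rewrite inE => /andP[/imsetP[x _ eC] /subsetP Cm].
  have eqcol y : col A' y = col B' y by rewrite -!colE // eqH'.
  have := eqcol x; rewrite /col -/(CC x) -[CC x]eC CA /= => /esym/orP[] //.
  case/existsP=> v /andP[vC _]; have /imsetP[m _] := Cm _ vC.
  by case: v {vC}.
apply: eq_card => h; rewrite !inE; apply/compat_glueP/imsetP=> [Hh|[A]]; last first.
  rewrite inE => AK -> x y xy; rewrite !colE // /col.
  by rewrite (CCE x y) // inE.
pose A := [set C in K | [exists m, (mid m \in C) && h m]].
have AK : A \subset K by apply/subsetP=> C; rewrite inE => /andP[].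
exists A; first by rewrite inE.
apply/ffunP=> m; rewrite ffunE /col.
have hE y : y \in CC (mid m) -> scolour f h g y = h m.
  by rewrite inE => /Hh <-.
have [mK|mK] := boolP (CC (mid m) \in K).
  have -> : [exists v, (outer v \in CC (mid m)) && colour f g v] = false.
    apply/existsP=> -[v /andP[vm _]]; move: mK; rewrite -(CCE _ _ vm).
    exact/negP/outK.
  rewrite orbF inE mK /=.
  apply/idP/existsP=> [hm|[m' /andP[/hE mm' hm']]]; last by rewrite -mm'.
  by exists m; rewrite component_refl.
rewrite inE (negbTE mK) /=.
apply/idP/existsP=> [hm|[v /andP[/hE <-]]]; last by rewrite scolour_outer.
have [v vm] : exists v, outer v \in CC (mid m).
  apply/existsP; apply: contraNT mK => /existsPn; exact: inK.
by exists v; rewrite vm -(scolour_outer f h g) (hE _ vm).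
Qed.

Lemma pow2_compat (m n : nat) d d' :
  (forall f g, 2 ^ m * compat d f g = 2 ^ n * compat d' f g)%N -> m = n /\ d = d'.
Proof.
move=> H; have emn : m = n.
  move: (H [ffun=> true] [ffun=> true]); rewrite !compat_cst !muln1 => /eqP.
  by rewrite eqn_exp2l // => /eqP.
split=> //; apply: compat_inj => f g; have /eqP := H f g.
by rewrite emn eqn_pmul2l ?expn_gt0 //; case: (compat d f g); case: (compat d' f g).
Qed.

Lemma comp_loopsA a b c :
  (loops a b + loops (comp a b) c = loops b c + loops a (comp b c))%N /\
  comp (comp a b) c = comp a (comp b c).
Proof.
apply: pow2_compat => f g.
move: (count_colours (comp a b) c f g) (count_colours a (comp b c) f g).
move: (count_colours a b f) (count_colours b c ^~ g).
move: (loops a b) (loops (comp a b) c) (loops b c) (loops a (comp b c)).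
move=> l1 l2 l3 l4 e1 e3 e2 e4; rewrite !expnD -!mulnA -e2 -e4.
transitivity (\sum_h \sum_h' compat a f h' * compat b h' h * compat c h g)%N.
  rewrite big_distrr; apply: eq_bigr => h _ /=.
  by rewrite mulnA -e1 big_distrl.
rewrite exchange_big big_distrr; apply: eq_bigr => h _ /=.
rewrite mulnCA -e3 big_distrr.
by apply: eq_bigr => h' _; rewrite /= mulnA.
Qed.

Lemma compat_did f g : compat did f g = (f == g).
Proof.
apply/idP/eqP=> [H|->].
  apply/ffunP=> m; move/forallP/(_ (inl m))/forallP/(_ (inr m))/implyP: H.
  by rewrite fibresE eqxx => /(_ isT)/eqP.
apply/forallP=> u; apply/forallP=> v; apply/implyP; rewrite fibresE.
by case: u v => m [] m' /eqP[/ord_inj ->].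
Qed.

Lemma comp_did_l a : loops did a = 0%N /\ comp did a = a.
Proof.
apply: pow2_compat => f g; rewrite -count_colours mul1n.
rewrite (bigD1 f) //= big1 ?addn0 => [|h /negbTE hf]; rewrite compat_did.
  by rewrite eqxx mul1n.
by rewrite eq_sym hf.
Qed.

Lemma comp_did_r a : loops a did = 0%N /\ comp a did = a.
Proof.
apply: pow2_compat => f g; rewrite -count_colours mul1n.
rewrite (bigD1 g) //= big1 ?addn0 => [|h /negbTE hf]; rewrite compat_did.
  by rewrite eqxx muln1.
by rewrite hf muln0.
Qed.

End Composition.

(* [x d] is the coefficient of the diagram [d] in [x]. *)
Definition partition_algebra (F : fieldType) (delta : F) (k : nat) : Type :=
  {ffun diagram k -> F^o}.
HB.instance Definition _ F delta k := Vector.on (@partition_algebra F delta k).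

HB.lock Definition dg (F : fieldType) (delta : F) (k : nat) (d : diagram k) :
  partition_algebra delta k := [ffun d' => (d' == d)%:R].
Arguments dg {F delta k} d.

HB.lock Definition pa_mul (F : fieldType) (delta : F) (k : nat)
    (x y : partition_algebra delta k) : partition_algebra delta k :=
  \sum_a \sum_b (x a * y b * delta ^+ loops a b : F) *: @dg F delta k (comp a b).

Section PartitionAlgebra.
Variables (F : fieldType) (delta : F) (k : nat).

Local Notation partition_algebra := (partition_algebra delta k).
Local Notation dg := (@dg F delta k).
Local Notation pa_mul := (@pa_mul F delta k).

Implicit Types x y z : partition_algebra.

Definition pa_one : partition_algebra := dg (did k).

Lemma dg_coef d d' : dg d d' = (d' == d)%:R.
Proof. by rewrite dg.unlock ffunE. Qed.

Lemma dgE x : x = \sum_d x d *: dg d.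
Proof.
apply/ffunP=> d; rewrite sum_ffunE (bigD1 d) //= big1 ?addr0 => [|d' d'd].
  by rewrite ffunE dg_coef eqxx [_ *: _]mulr1.
by rewrite ffunE dg_coef eq_sym (negbTE d'd) [_ *: _]mulr0.
Qed.

Lemma pa_mulDl : left_distributive pa_mul +%R.
Proof.
move=> x y z; rewrite pa_mul.unlock -big_split; apply: eq_bigr => a _.
rewrite -big_split; apply: eq_bigr => b _.
by rewrite ffunE !mulrDl scalerDl.
Qed.

Lemma pa_mulDr : right_distributive pa_mul +%R.
Proof.
move=> x y z; rewrite pa_mul.unlock -big_split; apply: eq_bigr => a _.
rewrite -big_split; apply: eq_bigr => b _.
by rewrite ffunE mulrDr mulrDl scalerDl.
Qed.

Lemma pa_scaleAl c x y : c *: pa_mul x y = pa_mul (c *: x) y.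
Proof.
rewrite pa_mul.unlock scaler_sumr; apply: eq_bigr => a _.
rewrite scaler_sumr; apply: eq_bigr => b _.
by rewrite ffunE scalerA !mulrA.
Qed.

Lemma pa_scaleAr c x y : c *: pa_mul x y = pa_mul x (c *: y).
Proof.
rewrite pa_mul.unlock scaler_sumr; apply: eq_bigr => a _.
rewrite scaler_sumr; apply: eq_bigr => b _.
by rewrite ffunE scalerA !mulrA [_ * x a]mulrC.
Qed.

Lemma pa_mul_suml I (s : seq I) (f : I -> partition_algebra) y :
  pa_mul (\sum_(i <- s) f i) y = \sum_(i <- s) pa_mul (f i) y.
Proof.
apply: (big_morph (fun x => pa_mul x y)) => [x z|]; first exact: pa_mulDl.
by apply: (addIr (pa_mul 0 y)); rewrite -pa_mulDl !add0r.
Qed.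

Lemma pa_mul_sumr I (s : seq I) (f : I -> partition_algebra) x :
  pa_mul x (\sum_(i <- s) f i) = \sum_(i <- s) pa_mul x (f i).
Proof.
apply: (big_morph (pa_mul x)) => [y z|]; first exact: pa_mulDr.
by apply: (addIr (pa_mul x 0)); rewrite -pa_mulDr !add0r.
Qed.

Lemma dg_sum (c : diagram k -> diagram k -> F)
    (G : diagram k -> diagram k -> partition_algebra) a b :
  \sum_a' \sum_b' (dg a a' * dg b b' * c a' b') *: G a' b' = c a b *: G a b.
Proof.
rewrite (bigD1 a) //= [X in _ + X]big1 ?addr0 => [|a' a'a].
  rewrite (bigD1 b) //= big1 ?addr0 => [|b' b'b].
    by rewrite !dg_coef !eqxx !mul1r.
  by rewrite !dg_coef (negbTE b'b) mulr0 mul0r scale0r.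
by rewrite big1 // => b' _; rewrite dg_coef (negbTE a'a) !mul0r scale0r.
Qed.

Lemma pa_mul_dg a b : pa_mul (dg a) (dg b) = delta ^+ loops a b *: dg (comp a b).
Proof. by rewrite pa_mul.unlock (dg_sum (fun a b => delta ^+ loops a b)). Qed.

Lemma pa_mulA_dg a b c :
  pa_mul (dg a) (pa_mul (dg b) (dg c)) = pa_mul (pa_mul (dg a) (dg b)) (dg c).
Proof.
rewrite (pa_mul_dg a b) (pa_mul_dg b c) -pa_scaleAr -pa_scaleAl.
rewrite (pa_mul_dg a (comp b c)) (pa_mul_dg (comp a b) c).
case: (comp_loopsA a b c) => + ->.
move: (loops a b) (loops b c) (loops _ c) (loops a _) => l1 l2 l3 l4 el.
by rewrite !scalerA -!exprD el.
Qed.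

Lemma pa_mulA : associative pa_mul.
Proof.
suff A (fx fy fz : diagram k -> F) :
    pa_mul (\sum_a fx a *: dg a) (pa_mul (\sum_b fy b *: dg b) (\sum_c fz c *: dg c)) =
    pa_mul (pa_mul (\sum_a fx a *: dg a) (\sum_b fy b *: dg b)) (\sum_c fz c *: dg c).
  by move=> x y z; rewrite (dgE x) (dgE y) (dgE z) A.
rewrite [LHS]pa_mul_suml [in RHS]pa_mul_suml [RHS]pa_mul_suml.
apply: eq_bigr => a _.
rewrite pa_mul_suml [LHS]pa_mul_sumr.
rewrite [pa_mul (fx a *: dg a) (\sum_b fy b *: dg b)]pa_mul_sumr [RHS]pa_mul_suml.
apply: eq_bigr => b _.
rewrite [in LHS]pa_mul_sumr [LHS]pa_mul_sumr [RHS]pa_mul_sumr.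
apply: eq_bigr => c _.
have sl e u v : pa_mul (e *: u) v = e *: pa_mul u v by rewrite pa_scaleAl.
have sr e u v : pa_mul u (e *: v) = e *: pa_mul u v by rewrite pa_scaleAr.
by rewrite !sl !sr !sl pa_mulA_dg [fy b *: _]scalerA mulrC -scalerA.
Qed.

Lemma pa_mul1l : left_id pa_one pa_mul.
Proof.
move=> x; rewrite {1}(dgE x) pa_mul_sumr [RHS]dgE; apply: eq_bigr => d _.
by rewrite -pa_scaleAr pa_mul_dg; have [-> ->] := comp_did_l d; rewrite scale1r.
Qed.

Lemma pa_mul1r : right_id pa_one pa_mul.
Proof.
move=> x; rewrite {1}(dgE x) pa_mul_suml [RHS]dgE; apply: eq_bigr => d _.
by rewrite -pa_scaleAl pa_mul_dg; have [-> ->] := comp_did_r d; rewrite scale1r.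
Qed.

Lemma pa_one_neq0 : pa_one != 0.
Proof.
apply/eqP=> /ffunP/(_ (did k)); rewrite dg_coef ffunE eqxx => /eqP.
by rewrite oner_eq0.
Qed.

HB.instance Definition _ := GRing.Zmodule_isNzRing.Build partition_algebra
  pa_mulA pa_mul1l pa_mul1r pa_mulDl pa_mulDr pa_one_neq0.
HB.instance Definition _ :=
  GRing.Lmodule_isLalgebra.Build F partition_algebra pa_scaleAl.
HB.instance Definition _ :=
  GRing.Lalgebra_isAlgebra.Build F partition_algebra pa_scaleAr.
HB.instance Definition _ := Algebra_isFalgebra.Build F partition_algebra.

Lemma dg_mul a b : dg a * dg b = delta ^+ loops a b *: dg (comp a b).
Proof. exact: pa_mul_dg. Qed.

End PartitionAlgebra.

Section Subalgebra.
Variables (F : fieldType) (delta : F) (r : nat).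

(* A_r is realised inside A_{2k} with k = uphalf r: it is all of A_{2k} when r is
   even, and the span of the diagrams joining k to k' when r is odd. *)
Definition joins_last (d : diagram (uphalf r)) : bool :=
  [forall m, (vnum m == uphalf r) ==> same_block d (inl m) (inr m)].

Definition pa_sub_vspace : {vspace partition_algebra delta (uphalf r)} :=
  <<[seq dg d | d <- enum [pred d | odd r ==> joins_last d]]>>%VS.

Lemma joins_last_did : joins_last (did _).
Proof. by apply/forallP=> m; rewrite fibresE eqxx implybT. Qed.

Lemma joins_last_comp a b : joins_last a -> joins_last b -> joins_last (comp a b).
Proof.
move=> /forallP ja /forallP jb; apply/forallP=> m; apply/implyP=> mk.
rewrite compE componentE; apply: (@connect_trans _ _ (mid m)).
  apply/connect1/existsP; exists (inl m); apply/existsP; exists (inr m).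
  by rewrite !eqxx (implyP (ja m)).
apply/connect1/existsP; exists (inl m); apply/existsP; exists (inr m).
by rewrite !eqxx (implyP (jb m)) ?orbT.
Qed.

Lemma mem_pa_sub d : odd r ==> joins_last d -> dg d \in pa_sub_vspace.
Proof. by move=> jd; apply/memv_span/map_f; rewrite mem_enum. Qed.

Fact pa_sub_is_aspace : is_aspace pa_sub_vspace.
Proof.
rewrite /is_aspace has_algid1; last by rewrite mem_pa_sub ?joins_last_did ?implybT.
suff UU u v : u \in pa_sub_vspace -> v \in pa_sub_vspace -> u * v \in pa_sub_vspace.
  exact/prodvP.
have sub (f : 'End(partition_algebra delta (uphalf r))) :
    (forall d, odd r ==> joins_last d -> f (dg d) \in pa_sub_vspace) ->
    forall w, w \in pa_sub_vspace -> f w \in pa_sub_vspace.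
  move=> H w wU; rewrite memv_preim; move: w wU; apply/subvP/span_subvP=> w.
  by case/mapP=> d; rewrite mem_enum => /H fd ->; rewrite -memv_preim.
move=> uU vU; have := sub (amulr v) _ u uU; rewrite lfunE; apply=> a ja.
rewrite lfunE /=; have := sub (amull (dg a)) _ v vU; rewrite lfunE; apply=> b jb.
rewrite lfunE /= dg_mul memvZ // mem_pa_sub //; apply/implyP=> r_odd.
by rewrite joins_last_comp ?(implyP ja) ?(implyP jb).
Qed.

Canonical pa_sub : {aspace partition_algebra delta (uphalf r)} :=
  ASpace pa_sub_is_aspace.

End Subalgebra.

Section JucysMurphy.
Variables (F : fieldType) (delta : F) (k : nat).

(* The indices are those of s_i (1 <= i < k) and e_n (1 <= n < 2k);
   the values outside these ranges are meaningless. *)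
Definition swap_num (i n : nat) : nat :=
  if n == i then i.+1 else if n == i.+1 then i else n.

Definition s_diagram (i : nat) : diagram k :=
  fibres (fun v => match v with
                   | inl m => vnum m
                   | inr m => swap_num i (vnum m)
                   end).

Definition cut_diagram (j : nat) : diagram k :=
  fibres (fun v => match v with
                   | inl m => (vnum m, false)
                   | inr m => (vnum m, vnum m == j)
                   end).

Definition merge_diagram (i : nat) : diagram k :=
  let f n := if n == i.+1 then i else n in
  fibres (fun v => match v with inl m => f (vnum m) | inr m => f (vnum m) end).

Local Notation A := (partition_algebra delta k).

Definition s_ (i : nat) : A := dg (s_diagram i).

(* e_{2j-1} = cut_diagram j and e_{2i} = merge_diagram i. *)
Definition e_ (n : nat) : A :=
  dg (if odd n then cut_diagram (uphalf n) else merge_diagram n./2).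

(* JModd n = L_{2n+1}, JMeven n = L_{2n+2}, sigma_even n = sigma_{2n+2} and
   sigma_odd n = sigma_{2n+3}. *)
Fixpoint JModd (n : nat) : A :=
  match n with
  | 0 => 0
  | n'.+1 => let i := n'.+1 in
      s_ i * JModd n' * s_ i
      - JMeven n' * e_ (2 * i) - e_ (2 * i) * JMeven n'
      + (delta%:A - JModd n') * e_ (2 * i) + sigma_even n'
  end
with JMeven (n : nat) : A :=
  match n with
  | 0 => e_ 1
  | n'.+1 => let i := n'.+1 in
      s_ i * JMeven n' * s_ i
      - s_ i * JMeven n' * e_ (2 * i) - e_ (2 * i) * JMeven n' * s_ i
      + e_ (2 * i) * JMeven n' * e_ (2 * i + 1) * e_ (2 * i) + sigma_odd n'
  end
with sigma_even (n : nat) : A :=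
  match n with
  | 0 => 1
  | n'.+1 => let i := n'.+2 in
      s_ (i - 1) * s_ i * sigma_even n' * s_ i * s_ (i - 1)
      + e_ (2 * i - 2) * JMeven n' * s_ i * e_ (2 * i - 2) * s_ i
      + s_ i * e_ (2 * i - 2) * JMeven n' * s_ i * e_ (2 * i - 2)
      - e_ (2 * i - 2) * JMeven n' * s_ (i - 1)
          * e_ (2 * i) * e_ (2 * i - 1) * e_ (2 * i - 2)
      - s_ i * e_ (2 * i - 2) * e_ (2 * i - 1) * e_ (2 * i)
          * s_ (i - 1) * JMeven n' * e_ (2 * i - 2) * s_ i
  end
with sigma_odd (n : nat) : A :=
  match n with
  | 0 => s_ 1
  | n'.+1 => let i := n'.+2 in
      s_ (i - 1) * s_ i * sigma_odd n' * s_ i * s_ (i - 1)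
      + s_ i * e_ (2 * i - 2) * JMeven n' * s_ i * e_ (2 * i - 2) * s_ i
      + e_ (2 * i - 2) * JMeven n' * s_ i * e_ (2 * i - 2)
      - s_ i * e_ (2 * i - 2) * JMeven n' * s_ (i - 1)
          * e_ (2 * i) * e_ (2 * i - 1) * e_ (2 * i - 2)
      - e_ (2 * i - 2) * e_ (2 * i - 1) * e_ (2 * i)
          * s_ (i - 1) * JMeven n' * e_ (2 * i - 2) * s_ i
  end.

(* JM n = L_n for n >= 1; it is read inside A_{2k} for n <= 2k. *)
Definition JM (n : nat) : A := if odd n then JModd n./2 else JMeven n./2.-1.

Definition normalised_JM (n : nat) : A := JM n - (delta / 2)%:A.

End JucysMurphy.

(* Imported only here: it rebinds [symmetric]. *)
From mathcomp Require Import mpoly.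

Section Supersymmetric.
Variables (F : fieldType) (r : nat).
Implicit Type p : {mpoly F[r]}.

(* The variable 'X_i of {mpoly F[r]} is x_{i+1}, so that the odd-indexed variables
   are those with i even. *)
Definition odd_indexed : {set 'I_r} := [set i : 'I_r | ~~ odd i].
Definition even_indexed : {set 'I_r} := [set i : 'I_r | odd i].

(* x_1 = y, x_2 = - y, where y is the variable 'X of {poly {mpoly F[r]}}. *)
Definition subst_y (i : 'I_r) : {poly {mpoly F[r]}} :=
  if i == 0%N :> nat then 'X else if i == 1%N :> nat then - 'X else ('X_i)%:P.

Definition subst_x12 p : {poly {mpoly F[r]}} :=
  mmap (fun c : F => (c%:MP)%:P) subst_y p.

(* The second condition is about two variables, hence is void for r <= 1. *)
Definition supersymmetric p : Prop :=
  [/\ forall s : 'S_r, perm_on odd_indexed s -> msym s p = p,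
      forall s : 'S_r, perm_on even_indexed s -> msym s p = p
    & (1 < r)%N -> exists q : {mpoly F[r]}, subst_x12 p = q%:P].

End Supersymmetric.

(* The value of p at x_i = N_i. The N_i commute, hence the order in which [mmap]
   multiplies them is immaterial and p |-> JM_eval p is the homomorphism of algebras
   that sends x_i to N_i. *)
Definition JM_eval (F : fieldType) (delta : F) (r : nat) (p : {mpoly F[r]}) :
    partition_algebra delta (uphalf r) :=
  mmap (in_alg (partition_algebra delta (uphalf r)))
       (fun i : 'I_r => normalised_JM delta (uphalf r) i.+1) p.

(* Main.v *)
Require Import Defs.
From HB Require Import structures.
From mathcomp Require Import all_boot all_order all_fingroup all_algebra all_field.
From mathcomp Require Import complex reals.
From mathcomp Require Import mpoly.
From mathcomp Require Import zify ring spectral.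

Set Implicit Arguments.
Unset Strict Implicit.
Unset Printing Implicit Defensive.
Import Order.TTheory GRing.Theory Num.Theory.
Local Open Scope ring_scope.

(** At delta = n, let C be a set of n colours. The algebra A_2k(n) acts on functions
    of the colourings f of k points: a diagram has entry 1 at (f, g) exactly when the
    colours f on its top row and g on its bottom row are constant on its blocks.
    This action commutes with the permutations of C, and in it the elements defined
    by the long recursion become explicit. At a colouring f,
    - L_{2i} sums, over all colours b, the effect of the transposition (f_i b) on the
      first i colours, and n - L_{2i-1} does the same on the first i - 1 colours;
    - sigma_{2i+1} and sigma_{2i} apply the transposition (f_i f_{i+1}) to the first
      i + 1, respectively i - 1, colours.
    Checking that these formulas satisfy the recursion is a short case analysis on
    which of two or three neighbouring colours coincide ([ev_JM]).

    Power sums are then central by telescoping. Let J_a be the sum of the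
    transpositions (a b) with b <> a, the Jucys-Murphy element of the symmetric group
    of C for which a comes last. Where f_i = a, the powers of L_{2i} - 1 are those of
    J_a acting on the first i colours, and the powers of n - 1 - L_{2i-1} those of J_a
    acting on the first i - 1. If P_m(C) is the sum of the m-th powers of the
    Jucys-Murphy elements of the symmetric group of C, taken in any order, then J_a^m
    is P_m(C) - P_m(C minus a) ([jm_psum_rem]). So the alternating sum of the powers
    collapses, up to a constant and a sign, to P_m(C) acting on all k colours, or, for
    odd r, to P_m of C deprived of the colour of the last point. It commutes with
    every diagram of A_r because diagrams commute with permutations of colours
    ([alt_psum_even_comm], [alt_psum_odd_comm]).

    For an arbitrary supersymmetric p, the operators L_i are real symmetric and
    commute, hence have a common eigenbasis. An operator that commutes with the
    alternating power sums only relates eigenvectors on which these agree, and a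
    supersymmetric polynomial takes equal values at two points with equal alternating
    power sums ([balanced_supersymmetric]). So p(N) commutes with A_r
    ([supersymmetric_rep_comm]).

    Finally the action is faithful as soon as C is large ([coef_eq0]), and the
    coefficients of p(N), and of its commutator with a diagram, are polynomials in
    delta. As they have the required zeros at infinitely many integers, they have them
    at every delta. The colours are bit strings of length t, so that n = 2^t: a
    colouring is then a family of t independent two-colourings. *)

(** * Supersymmetric polynomials at points with equal power sums *)

Lemma poly_interpolation (F : fieldType) (h : F -> F) (s : seq F) :
  exists q : {poly F}, {in s, forall u, q.[u] = h u}.
Proof.
elim: s => [|a s [q qP]]; first by exists 0.
have [a_s|a_s] := boolP (a \in s).
  by exists q => u; rewrite inE => /orP[/eqP->|]; apply: qP.
pose P := \prod_(u <- s) ('X - u%:P).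
have P0 u : (P.[u] == 0) = (u \in s) by rewrite -rootE root_prod_XsubC.
exists (q + ((h a - q.[a]) / P.[a]) *: P) => u.
rewrite hornerD hornerZ inE => /orP[/eqP->|us].
  by rewrite divfK ?P0 // addrC subrK.
have /eqP-> : P.[u] == 0 by rewrite P0.
by rewrite mulr0 addr0 qP.
Qed.

Section SupersymmetricValues.
Variables (F : numFieldType) (r : nat).
Implicit Types (p : {mpoly F[r]}) (x : 'I_r -> F) (z w : {ffun 'I_r -> F}).

(** In the coordinates z_i = (-1)^i x_i two variables of different parity cancel when
    they are equal. The relation says that the multisets of values at even and at odd
    indices of z and w have the same formal difference. *)
Definition balanced z w : Prop :=
  forall h : F -> F,
    \sum_(i < r) (-1) ^+ i * h (z i) = \sum_(i < r) (-1) ^+ i * h (w i).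

(** Only finitely many values occur, so h may be taken to be a polynomial. *)
Lemma balanced_pow z w :
  (forall m, \sum_(i < r) (-1) ^+ i * z i ^+ m = \sum_(i < r) (-1) ^+ i * w i ^+ m) ->
  balanced z w.
Proof.
move=> zw h; have [q qP] := poly_interpolation h (codom z ++ codom w).
have sumq (u : {ffun 'I_r -> F}) : {subset codom u <= codom z ++ codom w} ->
    \sum_(i < r) (-1) ^+ i * h (u i)
    = \sum_(j < size q) q`_j * \sum_(i < r) (-1) ^+ i * u i ^+ j.
  move=> su; under [RHS]eq_bigr => j _ do rewrite mulr_sumr.
  rewrite exchange_big; apply: eq_bigr => i _ /=.
  rewrite -qP ?su ?codom_f // horner_coef mulr_sumr.
  by apply: eq_bigr => j _; rewrite mulrCA.
rewrite !sumq; last 2 first.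
- by move=> u uw; rewrite mem_cat uw orbT.
- by move=> u uz; rewrite mem_cat uz.
by apply: eq_bigr => j _; rewrite zw.
Qed.

(** Test the relation on the indicator function of the value z i: the contribution of
    the index i must be compensated by some other disagreement. *)
Lemma balanced_partner z w i : balanced z w -> z i != w i ->
  exists j, (z j != w j) &&
    ((odd j == odd i) && (w j == z i) || (odd j != odd i) && (z j == z i)).
Proof.
move=> zw zwi; apply/existsP; apply: contraT => /existsPn /= no.
have /(congr1 ( *%R ((-1) ^+ odd i))) /eqP := zw (fun u => (u == z i)%:R).
rewrite -subr_eq0 -mulrBr -sumrB mulr_sumr.
suff /lt0r_neq0/negbTE-> :
    0 < \sum_(l < r) (-1) ^+ odd i * ((-1) ^+ l * (z l == z i)%:R
                                       - (-1) ^+ l * (w l == z i)%:R) :> F by [].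
rewrite (bigD1 i) //= eqxx eq_sym (negbTE zwi) mulr0 subr0 mulr1 signr_odd.
rewrite -expr2 sqrr_sign ltr_pwDl // sumr_ge0 // => l _.
rewrite -mulrBr -[_ ^+ l]signr_odd -[_ ^+ i]signr_odd mulrA -signr_addb.
have := no l; case: (eqVneq (z l) (w l)) => [->|_] /=; first by rewrite subrr mulr0.
case: (odd l) (odd i) => -[] /=; rewrite ?orbF ?expr0 ?expr1 => /negbTE->;
  by rewrite ?subr0 ?sub0r ?mulN1r ?opprK ?mul1r ?ler0n.
Qed.

Definition signed z (i : 'I_r) : F := (-1) ^+ i * z i.

Lemma msym_meval x p s : (msym s p).@[x] = p.@[fun i => x (s i)].
Proof.
rewrite /msym /mmap rmorph_sum mevalE; apply: eq_bigr => m _.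
rewrite rmorphM /= mevalC rmorph_prod; congr (_ * _); apply: eq_bigr => i _.
by rewrite rmorphXn /= mevalXU.
Qed.

Lemma supersymmetric_swap p z (i j : 'I_r) : supersymmetric p -> odd i = odd j ->
  p.@[signed [ffun l => z (tperm i j l)]] = p.@[signed z].
Proof.
move=> [p_odd p_even _] ij; have par l : odd (tperm i j l) = odd l.
  by case: tpermP => [->|->|].
have -> : p.@[signed z] = (msym (tperm i j) p).@[signed z].
  have [oi|ei] := boolP (odd i); [rewrite p_even | rewrite p_odd] => //.
  - apply/subsetP=> l; rewrite !inE; case: tpermP => [->|->|]; rewrite ?eqxx //.
    by rewrite -ij.
  - apply/subsetP=> l; rewrite !inE; case: tpermP => [->|->|]; rewrite ?eqxx //.
    by rewrite -ij.
rewrite msym_meval; apply: meval_eq => l.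
by rewrite /signed ffunE -[in RHS]signr_odd par signr_odd.
Qed.

Lemma subst_x12_eval p x v :
  (map_poly (meval x) (subst_x12 p)).[v]
  = p.@[fun i : 'I_r => if i == 0%N :> nat then v else
                        if i == 1%N :> nat then - v else x i].
Proof.
rewrite /subst_x12 /mmap rmorph_sum horner_sum mevalE; apply: eq_bigr => m _.
rewrite rmorphM hornerM /= map_polyC hornerC /= mevalC; congr (_ * _).
rewrite rmorph_prod horner_prod; apply: eq_bigr => i _.
rewrite rmorphXn horner_exp /subst_y; congr (_ ^+ _).
case: eqP => _; first by rewrite /= map_polyX hornerX.
case: eqP => _; first by rewrite rmorphN /= map_polyX hornerN hornerX.
by rewrite /= map_polyC hornerC /= mevalXU.
Qed.

(** After the two variables are moved to the first two places, the polynomial in y that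
    supersymmetry requires to be constant is evaluated at z i and at v. *)
Lemma supersymmetric_cancel p z (i j : 'I_r) v : supersymmetric p ->
  odd i != odd j -> z i = z j ->
  p.@[signed z]
  = p.@[signed [ffun l => if (l == i) || (l == j) then v else z l]].
Proof.
move=> ssp; wlog ei : i j / ~~ odd i => [W|].
  move=> ij zij; have [oi|ei] := boolP (odd i); last exact: W.
  rewrite (W j i) //; last by rewrite eq_sym.
    by congr (p.@[signed _]); apply/ffunP=> l; rewrite !ffunE orbC.
  by move: ij; rewrite oi; case: (odd j).
rewrite (negbTE ei) /= negbK => oj zij.
have r1 : (1 < r)%N.
  by rewrite (leq_trans _ (ltn_ord j)) // ltnS lt0n; case: (j : nat) oj.
pose i0 := Ordinal (ltnW r1); pose i1 := Ordinal r1.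
(* Bring the two variables to the first two places. *)
pose mv z := [ffun l => [ffun l' => z (tperm i i0 l')] (tperm j i1 l)] : {ffun 'I_r -> F}.
have mvE u : p.@[signed u] = p.@[signed (mv u)].
  by rewrite /mv !supersymmetric_swap //=; apply/negbTE.
have [_ _ /(_ r1)[q qP]] := ssp.
have i01 : i1 != i0 by [].
have ji0 : j != i0 by apply: contraTneq oj => ->.
have i1i : i1 != i by apply: contraNneq ei => <-.
have ij : i != j by apply: contraTneq oj => <-.
have fst u : mv u i0 = u i by rewrite !ffunE (tpermD ji0 i01) tpermR.
have snd u : mv u i1 = u j.
  by rewrite !ffunE tpermR tpermD // eq_sym.
pose x := signed (mv z).
have val (u : {ffun 'I_r -> F}) : u i = u j -> (forall l, l != i -> l != j -> u l = z l) ->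
    p.@[signed u] = q.@[x].
  move=> uij uz; rewrite mvE.
  have -> : q.@[x] = (map_poly (meval x) (subst_x12 p)).[u i].
    by rewrite qP map_polyC hornerC.
  rewrite subst_x12_eval; apply: meval_eq => l.
  case: eqP => [l0|/eqP l0].
    by rewrite (_ : l = i0) ?/signed ?fst ?mul1r //; apply: val_inj.
  case: eqP => [l1|/eqP l1].
    by rewrite (_ : l = i1) ?/signed ?snd -?uij ?mulN1r //; apply: val_inj.
  rewrite /x /signed; congr (_ * _); rewrite !ffunE uz //.
    apply/eqP=> /(congr1 (tperm i i0)); rewrite tpermL tpermK.
    by move/(congr1 (tperm j i1)); rewrite tpermK tpermD // => /(congr1 val)/eqP; apply/negP.
  apply/eqP=> /(congr1 (tperm i i0)); rewrite tpermK (tpermD ij) 1?eq_sym //.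
  by move/(congr1 (tperm j i1)); rewrite tpermK tpermL => /(congr1 val)/eqP; apply/negP.
rewrite !val ?ffunE ?eqxx ?orbT // => l /negbTE li /negbTE lj.
by rewrite ffunE li lj.
Qed.

(** Induction on the number of disagreements. At a disagreement i, the partner j of
    [balanced_partner] either allows w to be permuted so as to agree with z at i, or
    forms with i a cancelling pair of z, whose common value can be reset to w i. *)
Lemma balanced_supersymmetric p z w : supersymmetric p -> balanced z w ->
  p.@[signed z] = p.@[signed w].
Proof.
move=> ssp; have [n] := ubnP #|[set i | z i != w i]|.
elim: n => // n IH in z w *; rewrite ltnS => leD zw.
have [->//|] := eqVneq z w => zNw.
have /existsP[i zwi] : [exists i, z i != w i].
  apply: contraNT zNw => /existsPn eq_zw; apply/eqP/ffunP=> i.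
  by apply/eqP/negbNE/eq_zw.
(* Making the two sides agree at i without spoiling any agreement. *)
have step z' w' : z' i = w' i -> (forall l, z l = w l -> z' l = w' l) ->
    balanced z' w' -> p.@[signed z'] = p.@[signed w'].
  move=> e1 e2; apply: IH; apply: leq_trans leD.
  apply/proper_card/properP; split; last by exists i; rewrite !inE ?e1 ?eqxx.
  by apply/subsetP=> l; rewrite !inE; apply: contra => /eqP/e2->.
have [j /andP[zwj /orP[/andP[/eqP oji /eqP wj]|/andP[oji /eqP zj]]]] :=
  balanced_partner zw zwi.
- rewrite -(supersymmetric_swap w ssp (esym oji)); apply: step.
  + by rewrite ffunE tpermL wj.
  + move=> l eq_l; rewrite ffunE tpermD //.
      by apply: contraNneq zwi => ->; rewrite eq_l.
    by apply: contraNneq zwj => ->; rewrite eq_l.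
  + move=> h; rewrite zw (reindex_inj (@perm_inj _ (tperm i j))) /=.
    apply: eq_bigr => l _; rewrite ffunE; congr (_ * _).
    by rewrite -signr_odd -[RHS]signr_odd; case: tpermP => [->|->|] //; rewrite oji.
- rewrite (supersymmetric_cancel (w i) ssp oji zj); apply: step.
  + by rewrite ffunE eqxx orbT.
  + move=> l eq_l; rewrite ffunE; case: (eqVneq l j) => [lj|_] /=.
      by move: zwj; rewrite -lj eq_l eqxx.
    case: (eqVneq l i) => [li|//]; by move: zwi; rewrite -li eq_l eqxx.
  + have ji : j != i by apply: contraNneq oji => ->.
    move=> h; rewrite -zw (bigD1 i) //= (bigD1 j) //= [RHS](bigD1 i) //=.
    rewrite [in RHS](bigD1 j) //= !ffunE !eqxx orbT /= zj !addrA.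
    rewrite -!mulrDl; have -> : (-1) ^+ i + (-1) ^+ j = 0 :> F.
      rewrite -signr_odd -[_ ^+ j]signr_odd; move: oji.
      by case: (odd i) (odd j) => -[] //= _; rewrite ?addNr ?subrr.
    rewrite !mul0r !add0r; apply: eq_bigr => l /andP[/negbTE li /negbTE lj].
    by rewrite ffunE li lj.
Qed.

End SupersymmetricValues.

(** * Jucys-Murphy elements of a symmetric group *)

(** The power sums of a commuting pair obey Newton's recurrence, whose coefficients are
    the sum and the product of the pair. *)
Lemma eq_power_sums (A : pzRingType) (u v u' v' : A) m :
  u * v = v * u -> u' * v' = v' * u' -> u + v = u' + v' -> u * v = u' * v' ->
  u ^+ m + v ^+ m = u' ^+ m + v' ^+ m.
Proof.
move=> uv uv' eq_sum eq_prod.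
have rec (x y : A) n : x * y = y * x ->
    x ^+ n.+2 + y ^+ n.+2 = (x + y) * (x ^+ n.+1 + y ^+ n.+1) - x * y * (x ^+ n + y ^+ n).
  move=> xy; apply/esym/eqP; rewrite subr_eq.
  have -> : x * y * (x ^+ n + y ^+ n) = x * y ^+ n.+1 + y * x ^+ n.+1.
    by rewrite mulrDr {1}xy -!mulrA -!exprS addrC.
  apply/eqP; rewrite mulrDl !mulrDr -!exprS [RHS]addrACA; congr (_ + _).
  by rewrite addrC.
suff: u ^+ m + v ^+ m = u' ^+ m + v' ^+ m /\ u ^+ m.+1 + v ^+ m.+1 = u' ^+ m.+1 + v' ^+ m.+1.
  by case.
by elim: m => [|m [IH1 IH2]]; split; rewrite // !rec // eq_sum eq_prod IH1 IH2.
Qed.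

Section SymmetricGroupJM.
Variables (C : finType) (A : pzRingType) (rho : {perm C} -> A).
Hypothesis rhoM : {morph rho : g h / (g * h)%g >-> g * h}.
Implicit Types (s : seq C) (a b c : C).

(** The Jucys-Murphy element of the points s and a, when a is not in s and comes last. *)
Definition jm s a : A := \sum_(b <- s) rho (tperm a b).

Fixpoint jm_psum m s : A :=
  if s is a :: s' then jm s' a ^+ m + jm_psum m s' else 0.

Lemma jm_perm s s' a : perm_eq s s' -> jm s a = jm s' a.
Proof. exact: perm_big. Qed.

Lemma jm_conj s a g : jm s a * rho g = rho g * jm (map g s) (g a).
Proof.
rewrite /jm big_map mulr_suml mulr_sumr; apply: eq_bigr => b _.
by rewrite -!rhoM -tpermJ conjgC.
Qed.

Lemma jm_tperm s a b c : uniq s -> (b \in s) = (c \in s) ->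
  jm s a * rho (tperm b c) = rho (tperm b c) * jm s (tperm b c a).
Proof.
move=> us bc; rewrite jm_conj; congr (_ * _); apply/jm_perm/uniq_perm => //.
  by rewrite map_inj_uniq //; apply: perm_inj.
move=> x; rewrite -{1}[x](tpermK b c) mem_map; last exact: perm_inj.
by case: tpermP => [->|->|].
Qed.

(** Put T = rho (tperm a b), x = jm s a and y = jm s b. The pairs T + x, y and T + y, x
    consist of commuting elements, since a Jucys-Murphy element commutes with the
    permutations of the earlier points. They have the same sum, and the same product
    because x T = T y. *)
Lemma jm_exchange m s a b : uniq [:: a, b & s] ->
  jm (b :: s) a ^+ m + jm s b ^+ m = jm (a :: s) b ^+ m + jm s a ^+ m.
Proof.
rewrite /= inE negb_or => /and3P[/andP[ab a_s] b_s us].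
have com x y : x != y -> x \notin s -> y \notin s ->
    jm (y :: s) x * jm s y = jm s y * jm (y :: s) x.
  move=> xy xs ys; rewrite /jm [in RHS]mulr_suml mulr_sumr; apply: eq_big_seq => c cs.
  rewrite -/(jm (y :: s) x) jm_tperm ?inE ?eqxx ?cs ?orbT //=; last by rewrite ys.
  rewrite tpermD // 1?eq_sym //; by apply: contraNneq xs => ->.
have JE x y : jm (y :: s) x = rho (tperm x y) + jm s x by rewrite /jm big_cons.
apply: eq_power_sums.
- exact: com.
- by rewrite com // eq_sym.
- by rewrite !JE tpermC addrAC.
- have ba : b != a by rewrite eq_sym.
  rewrite (com b a) // !JE mulrDl mulrDr tpermC; congr (_ + _).
  by rewrite jm_tperm ?tpermR // (negbTE a_s) (negbTE b_s).
Qed.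

(** Repeated exchanges of neighbours bring a to the head of the list, where it is the last
    point in the sense of [jm]. *)
Lemma jm_psum_rem m s a : uniq s -> a \in s ->
  jm_psum m s = jm (rem a s) a ^+ m + jm_psum m (rem a s).
Proof.
elim: s => //= c s IH /andP[cs us]; rewrite inE eq_sym.
case: (eqVneq c a) => [->//|ca] /= a_s.
rewrite {}IH //= addrA [RHS]addrA; congr (_ + _).
rewrite [jm s c](@jm_perm s (a :: rem a s)) ?perm_to_rem // jm_exchange //.
rewrite /= inE negb_or ca rem_uniq // [a \in _]mem_rem_uniq // inE eqxx /= !andbT.
by apply: contra cs => /mem_rem.
Qed.

Lemma jm_comm x s a : (forall g, rho g * x = x * rho g) -> jm s a * x = x * jm s a.
Proof.
by move=> cx; rewrite mulr_suml mulr_sumr; apply: eq_bigr => b _; rewrite cx.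
Qed.

Lemma jm_psum_comm x m s : (forall g, rho g * x = x * rho g) ->
  jm_psum m s * x = x * jm_psum m s.
Proof.
move=> cx; elim: s => /= [|a s IH]; first by rewrite mul0r mulr0.
by rewrite mulrDl mulrDr IH; congr (_ + _); apply/esym/commrX/esym/jm_comm.
Qed.

End SymmetricGroupJM.

(** * Operators on functions of colourings *)
Section FunctionOperators.
Variables (F : fieldType) (X : finType).
Implicit Types (M : 'M[F]_#|X|) (phi psi : X -> F) (f g : X).

(** Matrices indexed by the colourings are compared through their effect on functions,
    see [ev_inj]; composites are then computed from the outside in, by [evM]. *)
Definition ev M phi f : F := \sum_g M (enum_rank f) (enum_rank g) * phi g.

Definition kernel_op (K : X -> X -> F) : 'M[F]_#|X| :=
  \matrix_(i, j) K (enum_val i) (enum_val j).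

Lemma ev_kernel K phi f : ev (kernel_op K) phi f = \sum_g K f g * phi g.
Proof. by apply: eq_bigr => g _; rewrite mxE !enum_rankK. Qed.

Lemma ev_delta M f g : ev M (fun h => (h == g)%:R) f = M (enum_rank f) (enum_rank g).
Proof.
rewrite /ev (bigD1 g) //= eqxx mulr1 big1 ?addr0 // => h /negbTE->.
by rewrite mulr0.
Qed.

Lemma ev_inj M M' : (forall phi f, ev M phi f = ev M' phi f) -> M = M'.
Proof.
move=> e; apply/matrixP=> a b; rewrite -[a]enum_valK -[b]enum_valK.
by rewrite -!ev_delta e.
Qed.

Lemma evD M M' phi f : ev (M + M') phi f = ev M phi f + ev M' phi f.
Proof. by rewrite /ev -big_split; apply: eq_bigr => g _; rewrite mxE mulrDl. Qed.

Lemma evN M phi f : ev (- M) phi f = - ev M phi f.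
Proof. by rewrite /ev -sumrN; apply: eq_bigr => g _; rewrite mxE mulNr. Qed.

Lemma evB M M' phi f : ev (M - M') phi f = ev M phi f - ev M' phi f.
Proof. by rewrite evD evN. Qed.

Lemma evZ c M phi f : ev (c *: M) phi f = c * ev M phi f.
Proof. by rewrite /ev mulr_sumr; apply: eq_bigr => g _; rewrite mxE mulrA. Qed.

Lemma ev0 phi f : ev 0 phi f = 0.
Proof. by apply: big1 => g _; rewrite mxE mul0r. Qed.

Lemma ev_sum I (s : seq I) (P : pred I) (M : I -> 'M_#|X|) phi f :
  ev (\sum_(i <- s | P i) M i) phi f = \sum_(i <- s | P i) ev (M i) phi f.
Proof. exact: (big_morph (fun M => ev M phi f) (fun _ _ => evD _ _ _ _) (ev0 _ _)). Qed.

Lemma evM M M' phi f : ev (M * M') phi f = ev M (ev M' phi) f.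
Proof.
rewrite /ev; under eq_bigr => g _ do rewrite mxE mulr_suml.
rewrite exchange_big (reindex_onto enum_rank enum_val) => [|i _]; last exact: enum_valK.
apply: eq_big => [g|g _]; first by rewrite enum_rankK eqxx.
by rewrite mulr_sumr; apply: eq_bigr => h _; rewrite mulrA.
Qed.

Lemma ev1 phi f : ev 1 phi f = phi f.
Proof.
rewrite /ev (bigD1 f) //= mxE eqxx mul1r big1 ?addr0 // => g gf.
by rewrite mxE (inj_eq enum_rank_inj) eq_sym (negbTE gf) mul0r.
Qed.

Definition pullback (u : X -> X) : 'M[F]_#|X| := kernel_op (fun f g => (g == u f)%:R).

Lemma ev_pullback u phi f : ev (pullback u) phi f = phi (u f).
Proof.
rewrite ev_kernel (bigD1 (u f)) //= eqxx mul1r big1 ?addr0 // => g /negbTE->.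
by rewrite mul0r.
Qed.

End FunctionOperators.

Section Colourings.
Variables (F : fieldType) (k : nat) (C : finType).
Local Notation X := {ffun 'I_k -> C}.
Local Notation op := 'M[F]_#|[the finType of X]|.
Implicit Types (f g : X) (phi psi : X -> F) (E : op) (c m : nat) (o : 'I_k).
Implicit Types (p q : {perm C}) (a b : C) (s : seq C).

Definition recolour c p f : X := [ffun i : 'I_k => if (i < c)%N then p (f i) else f i].

Lemma recolourM c p q f : recolour c (p * q)%g f = recolour c q (recolour c p f).
Proof. by apply/ffunP=> i; rewrite !ffunE; case: ifP => // _; rewrite permM. Qed.

Lemma recolour1 c f : recolour c 1%g f = f.
Proof. by apply/ffunP=> i; rewrite ffunE perm1 if_same. Qed.

Lemma recolour_tpermK c a b f : recolour c (tperm a b) (recolour c (tperm a b) f) = f.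
Proof. by rewrite -recolourM tperm2 recolour1. Qed.

Definition rho c p : op := pullback F (recolour c p).

Lemma rhoM c : {morph rho c : p q / (p * q)%g >-> p * q}.
Proof.
by move=> p q; apply: ev_inj => phi f; rewrite evM !ev_pullback recolourM.
Qed.

Lemma rho0 p : rho 0 p = 1.
Proof.
apply: ev_inj => phi f; rewrite ev_pullback ev1; congr phi.
by apply/ffunP=> i; rewrite ffunE.
Qed.

Definition equivariant c E := forall p, rho c p * E = E * rho c p.

(** The matrix of E is block diagonal for the partition of colourings according to the
    colour of o. *)
Definition local_at o E := forall phi psi f,
  (forall g, g o = f o -> phi g = psi g) -> ev E phi f = ev E psi f.

(** Near a colouring f, the operator D is U (f o). As E does not change the colour of o,
    it only meets that single operator, with which it commutes. *)
Lemma local_comm o (U : C -> op) (D E : op) :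
  (forall phi f, ev D phi f = ev (U (f o)) phi f) ->
  (forall a, U a * E = E * U a) -> local_at o E -> D * E = E * D.
Proof.
move=> DU UE locE; apply: ev_inj => phi f; rewrite !evM DU -evM UE evM.
by apply: locE => g gf; rewrite DU gf.
Qed.

(** With points counted from 0, this is the operator of L_{2o+2} if c = o + 1, and that
    of n - L_{2o+1} if c = o. *)
Definition jm_op c o : op :=
  kernel_op (fun f g => \sum_b (g == recolour c (tperm (f o) b) f)%:R).

Lemma ev_jm_op c o phi f :
  ev (jm_op c o) phi f = \sum_b phi (recolour c (tperm (f o) b) f).
Proof.
rewrite ev_kernel; under eq_bigr => g _ do rewrite mulr_suml.
rewrite exchange_big; apply: eq_bigr => b _.
by rewrite -ev_pullback ev_kernel.
Qed.

Lemma jm_op_equivariant c o c' : (c <= c')%N -> (o < c')%N -> equivariant c' (jm_op c o).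
Proof.
move=> cc' oc' p; apply: ev_inj => phi f; rewrite !evM ev_pullback !ev_jm_op.
rewrite (reindex_inj (@perm_inj _ p)); apply: eq_bigr => b _ /=.
rewrite ev_pullback; congr phi; apply/ffunP=> i; rewrite !ffunE oc'.
case: (ltnP i c) => // ic; rewrite (leq_trans ic cc').
by rewrite inj_tperm //; apply: perm_inj.
Qed.

Lemma jm_op_local c o o' : (c <= o')%N -> local_at o' (jm_op c o).
Proof.
move=> co phi psi f e; rewrite !ev_jm_op; apply: eq_bigr => b _.
by apply: e; rewrite ffunE ltnNge co.
Qed.

Local Notation JM c a := (jm (rho c) (rem a (enum C)) a).

(** The identity that is subtracted is the term of the trivial transposition. *)
Lemma ev_jm_op_twist c o phi f :
  ev (jm_op c o - 1) phi f = ev (JM c (f o)) phi f.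
Proof.
rewrite evB ev1 ev_jm_op ev_sum -big_enum /=.
have fo : f o \in enum C by rewrite mem_enum.
rewrite (perm_big _ (perm_to_rem fo)) big_cons.
rewrite tperm1 recolour1 addrAC subrr add0r.
by apply: eq_bigr => b _; rewrite ev_pullback.
Qed.

Lemma jm_op_comm c o c' o' : (c <= o')%N -> (c <= c')%N -> (o < c')%N ->
  jm_op c o * jm_op c' o' = jm_op c' o' * jm_op c o.
Proof.
move=> co cc oc; suff: (jm_op c' o' - 1) * jm_op c o = jm_op c o * (jm_op c' o' - 1).
  by rewrite mulrBl mulrBr mulr1 mul1r => /addIr.
apply: (@local_comm o' (fun a => JM c' a)) => [|a|]; last exact: jm_op_local.
  exact: ev_jm_op_twist.
by apply: jm_comm => p; apply: jm_op_equivariant.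
Qed.

Lemma jm_op_sym c o : (o == c :> nat) || (o.+1 == c) -> (jm_op c o)^T = jm_op c o.
Proof.
move=> oc; apply/matrixP=> i j; rewrite !mxE.
move: (enum_val i) (enum_val j) => f g {i j}.
case/orP: oc => /eqP<- {c}.
  apply: eq_bigr => b _; congr (_%:R); apply: congr1.
  suff H f1 f2 : f2 = recolour o (tperm (f1 o) b) f1 -> f1 = recolour o (tperm (f2 o) b) f2.
    by apply/eqP/eqP; apply: H.
  move=> ->; rewrite [recolour _ _ _ o]ffunE ltnn.
  by rewrite recolour_tpermK.
have K f1 f2 : \sum_b (f2 == recolour o.+1 (tperm (f1 o) b) f1)%:R
             = (f2 == recolour o.+1 (tperm (f1 o) (f2 o)) f1)%:R :> F.
  rewrite (bigD1 (f2 o)) //= big1 ?addr0 // => b bf2.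
  case: eqP => // e; move: bf2; rewrite e ffunE ltnSn tpermL eqxx //.
rewrite !K; move: (f o) (g o) => a b; congr (_%:R); apply: congr1; rewrite tpermC.
by apply/eqP/eqP=> ->; rewrite recolour_tpermK.
Qed.

Lemma jm_conj_rem c a b :
  rho c (tperm a b) * JM c b = JM c a * rho c (tperm a b).
Proof.
rewrite (jm_conj (rhoM c)) tpermL; congr (_ * _).
apply/jm_perm/uniq_perm.
- by rewrite rem_uniq ?enum_uniq.
- by rewrite map_inj_uniq ?rem_uniq ?enum_uniq //; apply: perm_inj.
move=> x; rewrite -[x in RHS](tpermK a b) mem_map; last exact: perm_inj.
rewrite !mem_rem_uniq ?enum_uniq // !inE !mem_enum !inE !andbT.
by rewrite -[in RHS](inj_eq (@perm_inj _ (tperm a b))) tpermK tpermL.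
Qed.

(** If c = o, the recolourings leave the colour of o alone and the powers are taken with
    f o fixed. If c = o + 1, the colour of o becomes b, and conjugation by the
    transposition turns the Jucys-Murphy element of b back into that of f o. *)
Lemma ev_jm_op_pow c o m phi f : (o == c :> nat) || (o.+1 == c) ->
  ev ((jm_op c o - 1) ^+ m) phi f = ev (JM c (f o) ^+ m) phi f.
Proof.
move=> oc; elim: m => [|m IH] in phi f *; first by [].
rewrite [in LHS]exprS evM ev_jm_op_twist /jm.
rewrite ev_sum; case/orP: oc IH => /eqP <- IH {c}.
  rewrite exprS evM ev_sum; apply: eq_bigr => b _.
  by rewrite !ev_pullback IH ffunE ltnn.
rewrite exprSr evM.
have tr b : rho o.+1 (tperm (f o) b) * JM o.+1 b ^+ m
           = JM o.+1 (f o) ^+ m * rho o.+1 (tperm (f o) b).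
  elim: m {IH} => [|m IH]; first by rewrite mulr1 mul1r.
  by rewrite !exprS mulrA jm_conj_rem -[LHS]mulrA IH mulrA.
rewrite -evM mulr_sumr ev_sum; apply: eq_bigr => b _.
by rewrite ev_pullback IH ffunE ltnSn tpermL -tr evM ev_pullback.
Qed.

Lemma ev_jm_psum m c o phi f : (o == c :> nat) || (o.+1 == c) ->
  ev ((jm_op c o - 1) ^+ m) phi f
  = ev (jm_psum (rho c) m (enum C) - jm_psum (rho c) m (rem (f o) (enum C))) phi f.
Proof.
have fo : f o \in enum C by rewrite mem_enum.
by move=> oc; rewrite ev_jm_op_pow // (jm_psum_rem (rhoM c) m (enum_uniq C) fo) addrK.
Qed.

(** The permutations involved fix the colour of o, so applying them to o as well or not
    makes no difference. *)
Lemma ev_jm_psum_fix m o s phi f : f o \notin s ->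
  ev (jm_psum (rho o.+1) m s) phi f = ev (jm_psum (rho o) m s) phi f.
Proof.
elim: s => //= a s IH; rewrite inE negb_or => /andP[fa fs]; rewrite !evD {}IH //.
congr (_ + _); elim: m => [//|m IH] in f fa fs *; rewrite !exprS !evM !ev_sum.
apply: eq_big_seq => b bs; rewrite !ev_pullback.
have fix_o : tperm a b (f o) = f o.
  by rewrite tpermD // eq_sym //; apply: contraNneq fs => ->.
have -> : recolour o.+1 (tperm a b) f = recolour o (tperm a b) f.
  apply/ffunP=> i; rewrite !ffunE ltnS leq_eqVlt.
  by case: eqP => [/ord_inj->|_] //=; rewrite ltnn fix_o.
by apply: IH; rewrite ffunE ltnn.
Qed.

(** The operators of n - L_1, L_2, n - L_3, L_4 and so on, in this order; the default
    value 0 is taken beyond the 2k of them. *)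
Definition jm_at (t : nat) : op := oapp (jm_op (uphalf t)) 0 (insub t./2).

Lemma jm_atE t o : o = t./2 :> nat -> jm_at t = jm_op (uphalf t) o.
Proof.
by move=> ot; rewrite /jm_at -ot insubT //= => ?; congr jm_op; apply: val_inj.
Qed.

Definition alt_psum m r : op := \sum_(t < r) (-1) ^+ t *: (jm_at t - 1) ^+ m.

Lemma alt_psumS m r : alt_psum m r.+1 = alt_psum m r + (-1) ^+ r *: (jm_at r - 1) ^+ m.
Proof. by rewrite /alt_psum big_ord_recr. Qed.

(** The operators with c = o and c = o + 1 contribute P_m(C) on the first o colours minus
    P_m(C) on the first o + 1 colours: their terms without f o agree by
    [ev_jm_psum_fix]. *)
Lemma ev_alt_psum_even m j phi f : (j <= k)%N ->
  ev (alt_psum m j.*2) phi f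
  = ev (jm_psum (rho 0) m (enum C) - jm_psum (rho j) m (enum C)) phi f.
Proof.
elim: j => [|j IH] jk; first by rewrite subrr /alt_psum big_ord0.
pose o := Ordinal jk; rewrite doubleS !alt_psumS !evD {}IH ?(ltnW jk) //.
rewrite (@jm_atE _ o) /= ?doubleK // (@jm_atE _ o) /= ?uphalf_double //.
rewrite doubleK exprS -signr_odd odd_double mulr1 scale1r scaleN1r evN.
rewrite (@ev_jm_psum m j o) ?eqxx // (@ev_jm_psum m j.+1 o) ?eqxx ?orbT //.
rewrite !evB (@ev_jm_psum_fix m o (rem (f o) (enum C))) ?mem_rem_uniqF ?enum_uniq //.
by rewrite evN -[nat_of_ord o]/j opprB !addrA !subrK.
Qed.

Lemma ev_alt_psum_odd m o phi f :
  ev (alt_psum m o.*2.+1) phi f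
  = ev (jm_psum (rho 0) m (enum C) - jm_psum (rho o) m (rem (f o) (enum C))) phi f.
Proof.
rewrite alt_psumS evD ev_alt_psum_even ?(ltnW (ltn_ord o)) //.
rewrite (@jm_atE _ o) /= ?doubleK // uphalf_double -signr_odd odd_double scale1r.
by rewrite (@ev_jm_psum m o o) ?eqxx // !evB addrA subrK.
Qed.

Lemma jm_psum0_comm m s E : jm_psum (rho 0) m s * E = E * jm_psum (rho 0) m s.
Proof. by apply: jm_psum_comm => p; rewrite rho0 mul1r mulr1. Qed.

Lemma alt_psum_even_comm m E : equivariant k E ->
  alt_psum m k.*2 * E = E * alt_psum m k.*2.
Proof.
move=> eqE; have -> : alt_psum m k.*2
    = jm_psum (rho 0) m (enum C) - jm_psum (rho k) m (enum C).
  by apply: ev_inj => phi f; apply: ev_alt_psum_even.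
by rewrite mulrBl mulrBr jm_psum0_comm (jm_psum_comm _ _ eqE).
Qed.

(** The sum is a different operator for each colour of the last point o, so E has to
    preserve that colour. *)
Lemma alt_psum_odd_comm m o E : o.+1 = k -> equivariant k E -> local_at o E ->
  alt_psum m o.*2.+1 * E = E * alt_psum m o.*2.+1.
Proof.
move=> ok eqE; apply: (@local_comm o (fun a =>
  jm_psum (rho 0) m (enum C) - jm_psum (rho k) m (rem a (enum C)))) => [phi f|a].
  have -> : rho k = rho o.+1 :> ({perm C} -> op) by rewrite ok.
  rewrite ev_alt_psum_odd !evB ev_jm_psum_fix //.
  by rewrite mem_rem_uniqF ?enum_uniq.
by rewrite mulrBl mulrBr jm_psum0_comm (jm_psum_comm _ _ eqE).
Qed.

End Colourings.

(** * The action of the partition algebra *)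
Section Respects.
Variables (k : nat) (C : finType).
Local Notation X := {ffun 'I_k -> C}.
Implicit Types (d : diagram k) (f g h : X).

Definition vcolour f g (v : vertex k) : C :=
  match v with inl i => f i | inr i => g i end.

Definition respects d f g : bool :=
  [forall u, forall v, same_block d u v ==> (vcolour f g u == vcolour f g v)].

Lemma respectsP d f g :
  reflect (forall u v, same_block d u v -> vcolour f g u = vcolour f g v)
          (respects d f g).
Proof.
apply: (iffP idP) => [H u v uv|H].
  by apply/eqP; move/forallP/(_ u)/forallP/(_ v)/implyP: H; apply.
by apply/forallP=> u; apply/forallP=> v; apply/implyP=> /H->.
Qed.

Lemma respects_fibres (T : eqType) (lab : vertex k -> T) f g :
  reflect (forall u v, lab u = lab v -> vcolour f g u = vcolour f g v)
          (respects (fibres lab) f g).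
Proof.
by apply: (iffP (respectsP _ _ _)) => H u v; [move/eqP|];
  rewrite -?fibresE ?fibresE => // ?; apply: H; rewrite ?fibresE //; apply/eqP.
Qed.

Lemma respects_did f g : respects (did k) f g = (f == g).
Proof.
apply/respects_fibres/eqP=> [H|->]; first by apply/ffunP=> i; apply: (H (inl i) (inr i)).
by case=> i [] j /eqP; rewrite eqSS => /eqP/ord_inj->.
Qed.

Lemma respects_recolour d p f g :
  respects d (recolour k p f) (recolour k p g) = respects d f g.
Proof.
have E (f' g' : X) v : vcolour (recolour k p f') (recolour k p g') v = p (vcolour f' g' v).
  by case: v => i /=; rewrite ffunE ltn_ord.
apply/respectsP/respectsP=> H u v /H; first by rewrite !E => /perm_inj.
by rewrite !E => ->.
Qed.

End Respects.

Lemma prod_bool (I : finType) (b : pred I) : (\prod_i b i = [forall i, b i] :> nat)%N.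
Proof.
have [/forallP H|/forallPn[i /negbTE bi]] := boolP [forall i, b i].
  by rewrite big1 // => i _; rewrite H.
by rewrite (bigD1 i) //= bi mul0n.
Qed.

Section CountBits.
Variables (k t : nat).
Local Notation C := {ffun 'I_t -> bool}.
Local Notation X := {ffun 'I_k -> C}.
Implicit Types (a b d : diagram k) (f g h : X).

Definition bit (j : 'I_t) f : {ffun 'I_k -> bool} := [ffun i => f i j].

Lemma respects_bits d f g : respects d f g = [forall j, compat d (bit j f) (bit j g)].
Proof.
have E j v : colour (bit j f) (bit j g) v = vcolour f g v j.
  by case: v => i /=; rewrite ffunE.
apply/respectsP/forallP=> [H j|H u v uv].
  apply/forallP=> u; apply/forallP=> v; apply/implyP=> uv.
  by rewrite !E (H u v uv).
apply/ffunP=> j; apply/eqP; rewrite -!E.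
by move/forallP/(_ u)/forallP/(_ v)/implyP: (H j); apply.
Qed.

(** Colours are compared bit by bit, so the colourings of the middle row are counted
    for each bit separately by [count_colours]. *)
Lemma count_respects a b f g :
  (\sum_h respects a f h * respects b h g
   = #|{: C}| ^ loops a b * respects (Defs.comp a b) f g)%N.
Proof.
have -> : (#|{: C}| ^ loops a b = \prod_(j < t) 2 ^ loops a b)%N.
  by rewrite card_ffun card_bool card_ord big_const card_ord iter_muln_1 -!expnM mulnC.
rewrite respects_bits -prod_bool -big_split /=.
under [RHS]eq_bigr => j _ do rewrite -count_colours.
rewrite bigA_distr_bigA /=.
pose tr (H : {ffun 'I_t -> {ffun 'I_k -> bool}}) : X := [ffun i => [ffun j => H j i]].
rewrite (reindex tr) /=; last first.
  exists (fun h => [ffun j => bit j h]) => h _; apply/ffunP=> i; apply/ffunP=> j;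
  by rewrite !ffunE.
apply: eq_bigr => H _; rewrite !respects_bits -!prod_bool -big_split /=.
apply: eq_bigr => j _; have -> // : bit j (tr H) = H j.
by apply/ffunP=> i; rewrite !ffunE.
Qed.

End CountBits.

Section Representation.
Variables (F : fieldType) (k t : nat).
Local Notation C := {ffun 'I_t -> bool}.
Local Notation X := {ffun 'I_k -> C}.
Local Notation delta := (#|{: C}|%:R : F).
Local Notation A := (partition_algebra delta k).
Local Notation op := 'M[F]_#|[the finType of X]|.
Implicit Types (x y : A) (f g h : X) (phi : X -> F) (d : diagram k).

Definition rep x : op :=
  kernel_op (fun f g => \sum_d x d * (respects d f g)%:R).

Lemma ev_rep x phi f :
  ev (rep x) phi f = \sum_g (\sum_d x d * (respects d f g)%:R) * phi g.
Proof. exact: ev_kernel. Qed.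

Lemma ev_dg d phi f : ev (rep (dg d)) phi f = \sum_(g | respects d f g) phi g.
Proof.
rewrite ev_rep [RHS]big_mkcond; apply: eq_bigr => g _.
rewrite (bigD1 d) //= big1 ?addr0 => [|d' /negbTE dd']; rewrite dg_coef.
  by rewrite eqxx mul1r; case: respects; rewrite ?mul1r ?mul0r.
by rewrite dd' mul0r.
Qed.

Lemma repD x y : rep (x + y) = rep x + rep y.
Proof.
apply: ev_inj => phi f; rewrite evD !ev_rep -big_split; apply: eq_bigr => g _.
rewrite /= -mulrDl -big_split; congr (_ * _); apply: eq_bigr => d _.
by rewrite ffunE mulrDl.
Qed.

Lemma repZ c x : rep (c *: x) = c *: rep x.
Proof.
apply: ev_inj => phi f; rewrite evZ !ev_rep mulr_sumr; apply: eq_bigr => g _.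
rewrite mulrA mulr_sumr; congr (_ * _); apply: eq_bigr => d _.
by rewrite ffunE mulrA.
Qed.

Lemma repN x : rep (- x) = - rep x.
Proof. by rewrite -scaleN1r repZ scaleN1r. Qed.

Lemma repB x y : rep (x - y) = rep x - rep y.
Proof. by rewrite repD repN. Qed.

Lemma rep0 : rep 0 = 0.
Proof. by rewrite -[0 in LHS](scale0r 0) repZ scale0r. Qed.

Lemma rep_sum I (s : seq I) (P : pred I) (G : I -> A) :
  rep (\sum_(i <- s | P i) G i) = \sum_(i <- s | P i) rep (G i).
Proof. exact: (big_morph rep repD rep0). Qed.

Lemma rep1 : rep 1 = 1.
Proof.
apply: ev_inj => phi f; rewrite ev_dg ev1 (big_pred1 f) // => g.
by rewrite respects_did eq_sym.
Qed.

Lemma repM_dg a b : rep (dg a * dg b) = rep (dg a) * rep (dg b).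
Proof.
apply: ev_inj => phi f; rewrite evM dg_mul repZ evZ !ev_dg.
under [RHS]eq_bigr => h _ do rewrite ev_dg big_mkcond /=.
rewrite [RHS]big_mkcond /=.
transitivity (\sum_h \sum_g (respects a f h * respects b h g)%:R * phi g); last first.
  apply: eq_bigr => h _; case: respects; last first.
    by apply: big1 => g _; rewrite mul0r.
  by apply: eq_bigr => g _; rewrite mul1n; case: respects; rewrite ?mul0r ?mul1r.
rewrite exchange_big /= mulr_sumr [LHS]big_mkcond; apply: eq_bigr => g _.
rewrite -mulr_suml -natr_sum count_respects natrM natrX.
by case: respects; rewrite ?mulr1 // mulr0 mul0r.
Qed.

Lemma repM x y : rep (x * y) = rep x * rep y.
Proof.
rewrite (dgE x) (dgE y) mulr_suml !rep_sum mulr_suml; apply: eq_bigr => a _.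
rewrite mulr_sumr mulr_sumr rep_sum; apply: eq_bigr => b _.
by rewrite -scalerAl -scalerAr !repZ repM_dg -[RHS]/(_ *m _) -scalemxAl -scalemxAr.
Qed.

Lemma repX x m : rep (x ^+ m) = rep x ^+ m.
Proof. by elim: m => [|m IH]; rewrite ?rep1 // !exprS repM IH. Qed.

End Representation.

Section Generators.
Variables (F : fieldType) (k t : nat).
Local Notation C := {ffun 'I_t -> bool}.
Local Notation X := {ffun 'I_k -> C}.
Local Notation delta := (#|{: C}|%:R : F).
Local Notation A := (partition_algebra delta k).
Implicit Types (f g : X) (phi : X -> F) (d : diagram k) (o : 'I_k).

(** Each vertex u takes its colour from the point w u, which its label determines. *)
Lemma same_label_colour (lab : vertex k -> nat) (w : vertex k -> 'I_k) f g :
  (forall u, lab u = (w u).+1) -> (forall u, vcolour f g u = f (w u)) ->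
  forall u v, lab u = lab v -> vcolour f g u = vcolour f g v.
Proof.
move=> labw colw u v; rewrite !labw => -[/ord_inj wuv].
by rewrite !colw wuv.
Qed.

Lemma ev_swap o o' phi f : o' = o.+1 :> nat ->
  ev (rep (s_ delta k o.+1)) phi f = phi [ffun i => f (tperm o o' i)].
Proof.
move=> adj; rewrite ev_dg (big_pred1 [ffun i => f (tperm o o' i)]) // => g.
have swapE (i : 'I_k) : swap_num o.+1 (vnum i) = (tperm o o' i).+1.
  rewrite /swap_num /vnum !eqSS; case: tpermP => [->|->|/eqP no /eqP no'].
  - by rewrite eqxx adj.
  - by rewrite adj (gtn_eqF (ltnSn o)) eqxx.
  - by rewrite -adj !(inj_eq (@ord_inj _)) (negbTE no) (negbTE no').
apply/respects_fibres/eqP=> [H|->].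
  by apply/ffunP=> i; rewrite ffunE; apply: (H (inr i) (inl _)); rewrite swapE.
apply: (@same_label_colour _ (fun u => match u with
  | inl i => i | inr i => tperm o o' i end)) => -[] i //=.
by rewrite ffunE.
Qed.

Lemma ev_merge o o' phi f : o' = o.+1 :> nat ->
  ev (rep (e_ delta k (2 * o.+1))) phi f = if f o == f o' then phi f else 0.
Proof.
move=> adj; rewrite /e_ mul2n odd_double doubleK ev_dg.
pose lab := (fun n : nat => if n == o.+2 then o.+1 else n).
have lab1 : lab (vnum o') = lab (vnum o).
  by rewrite /lab /vnum adj eqxx eqSS (ltn_eqF (ltnSn o)).
have respE g : respects (merge_diagram k o.+1) f g = (f o == f o') && (g == f).
  apply/respects_fibres/andP=> [H|[/eqP fo /eqP->]].
    split; first by apply/eqP/(H (inl o) (inl o')).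
    by apply/eqP/ffunP=> i; apply: (H (inr i) (inl i)).
  apply: (@same_label_colour _ (fun u => match u with
    | inl i => if i == o' then o else i | inr i => if i == o' then o else i end)) => -[] i;
  rewrite /= /vnum; case: (eqVneq i o') => [->|io'] //.
  - by rewrite adj eqxx.
  - by rewrite eqSS -adj (inj_eq (@ord_inj _)) (negbTE io').
  - by rewrite adj eqxx.
  - by rewrite eqSS -adj (inj_eq (@ord_inj _)) (negbTE io').
under eq_bigl => g do rewrite respE.
by case: eqP => _ /=; rewrite ?big_pred0_eq // big_pred1_eq.
Qed.

Lemma ev_cut o phi f :
  ev (rep (e_ delta k (2 * o).+1)) phi f
  = \sum_c phi [ffun i => if i == o then c else f i].
Proof.
rewrite /e_ mul2n [odd _]/= odd_double [uphalf _]/= doubleK ev_dg.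
have respE g : respects (cut_diagram k o.+1) f g = [forall i, (i != o) ==> (g i == f i)].
  apply/respects_fibres/forallP=> [H i|H].
    apply/implyP=> io; apply/eqP/(H (inr i) (inl i)).
    by rewrite /vnum eqSS (inj_eq (@ord_inj _)) (negbTE io).
  have E i : i != o -> g i = f i by move=> io; apply/eqP/(implyP (H i)).
  case=> i [] j /= [] /ord_inj-> //; rewrite /vnum ?eqSS ?(inj_eq (@ord_inj _)).
    by move/esym/negbT/E->.
  by move/negbT/E->.
under eq_bigl => g do rewrite respE.
rewrite (reindex_onto (fun c => [ffun i => if i == o then c else f i]) (fun g => g o)).
  apply: eq_bigl => c; rewrite ffunE eqxx eqxx andbT.
  by apply/forallP=> i; apply/implyP=> /negbTE io; rewrite ffunE io.
move=> g /forallP H; apply/ffunP=> i; rewrite ffunE.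
by case: eqVneq => [->//|io]; apply/esym/eqP/(implyP (H i)).
Qed.

End Generators.

(** * The Jucys-Murphy elements as operators *)
Section JMAction.
Variables (F : fieldType) (k t : nat).
Local Notation C := {ffun 'I_t -> bool}.
Local Notation X := {ffun 'I_k -> C}.
Local Notation delta := (#|{: C}|%:R : F).
Implicit Types (f : X) (phi : X -> F) (o : 'I_k) (p : {perm C}) (l : seq C) (n : nat).
Implicit Types (x y z : C).

(** The colourings met in the recursion: the first n colours of f are permuted by p, the
    following ones are replaced by the list l, and f provides the rest. *)
Definition window n p l f : X :=
  [ffun i : 'I_k => if (i < n)%N then p (f i) else nth (f i) l (i - n)].

(** The induction step lowers n by one, which exposes one more colour in the list. *)
Lemma windowS n p l f (nk : (n < k)%N) :
  window n.+1 p l f = window n p (p (f (Ordinal nk)) :: l) f.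
Proof.
apply/ffunP=> i; rewrite !ffunE ltnS.
case: (ltngtP i n) => [//|ni|eq_in].
  by rewrite -(subnSK ni).
by rewrite eq_in subnn /=; congr (p (f _)); apply: val_inj.
Qed.

Lemma window0 p q l f : window 0 p l f = window 0 q l f.
Proof. by apply/ffunP=> i; rewrite !ffunE. Qed.

Lemma window_at n p l1 x l2 f o : o = (n + size l1)%N :> nat ->
  window n p (l1 ++ x :: l2) f o = x.
Proof.
by move=> on; rewrite ffunE on ltnNge leq_addr addKn nth_cat ltnn subnn.
Qed.

Lemma window_set n p l1 x y l2 f o : o = (n + size l1)%N :> nat ->
  [ffun i => if i == o then y else window n p (l1 ++ x :: l2) f i]
  = window n p (l1 ++ y :: l2) f.
Proof.
move=> on; apply/ffunP=> i; rewrite ffunE; case: eqVneq => [->|].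
  by rewrite window_at.
rewrite -val_eqE /= on !ffunE !nth_cat => io; case: ltnP => // ni.
case: ltnP => // li; have -> : (i - n - size l1 = (i - n - size l1).-1.+1)%N by lia.
by [].
Qed.

Lemma window_swap n p l1 x y l2 f o o' :
  o = (n + size l1)%N :> nat -> o' = o.+1 :> nat ->
  [ffun i => window n p (l1 ++ x :: y :: l2) f (tperm o o' i)]
  = window n p (l1 ++ y :: x :: l2) f.
Proof.
move=> on adj; have o'n : o' = (n + size (rcons l1 x))%N :> nat by rewrite size_rcons; lia.
apply/ffunP=> i; rewrite ffunE; case: tpermP => [->|->|/eqP io /eqP io'].
- rewrite -cat_rcons (window_at _ _ _ _ o'n) window_at //.
- rewrite window_at // -cat_rcons window_at // size_rcons; lia.
move: io io'; rewrite -!val_eqE /= adj on !ffunE !nth_cat => io io'.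
case: ltnP => // ni; case: ltnP => // li.
have -> : (i - n - size l1 = (i - n - size l1).-2.+2)%N by lia.
by [].
Qed.

Lemma ev_swap_window l1 n p x y l2 f phi : ((n + size l1).+1 < k)%N ->
  ev (rep (s_ delta k (n + size l1).+1)) phi (window n p (l1 ++ x :: y :: l2) f)
  = phi (window n p (l1 ++ y :: x :: l2) f).
Proof.
move=> nk; pose o := Ordinal (ltnW nk); pose o' := Ordinal nk.
rewrite -[(n + size l1)%N]/(nat_of_ord o) (@ev_swap _ _ _ o o') //.
by rewrite window_swap.
Qed.

Lemma ev_merge_window l1 n p x y l2 f phi : ((n + size l1).+1 < k)%N ->
  ev (rep (e_ delta k (2 * (n + size l1).+1))) phi (window n p (l1 ++ x :: y :: l2) f)
  = if x == y then phi (window n p (l1 ++ x :: y :: l2) f) else 0.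
Proof.
move=> nk; pose o := Ordinal (ltnW nk); pose o' := Ordinal nk.
rewrite -[(n + size l1)%N]/(nat_of_ord o) (@ev_merge _ _ _ o o') // window_at //.
by rewrite -cat_rcons window_at // size_rcons addnS.
Qed.

Lemma ev_cut_window l1 n p x l2 f phi : (n + size l1 < k)%N ->
  ev (rep (e_ delta k (2 * (n + size l1)).+1)) phi (window n p (l1 ++ x :: l2) f)
  = \sum_c phi (window n p (l1 ++ c :: l2) f).
Proof.
move=> nk; pose o := Ordinal nk.
rewrite -[(n + size l1)%N]/(nat_of_ord o) ev_cut.
by apply: eq_bigr => c _; rewrite window_set.
Qed.

(** In the four specifications p is arbitrary because one operator is applied to the
    outcome of another; the colours x and y are those of the points n and n + 1, counted
    from 0. *)
Definition JModd_spec n := forall p x l f phi,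
  ev (rep (JModd delta k n)) phi (window n p (x :: l) f)
  = \sum_b (phi (window n p (x :: l) f)
            - phi (window n (p * tperm x b)%g (x :: l) f)).

Definition JMeven_spec n := forall p x l f phi,
  ev (rep (JMeven delta k n)) phi (window n p (x :: l) f)
  = \sum_b phi (window n (p * tperm x b)%g (b :: l) f).

Definition sigma_even_spec n := forall p x y l f phi,
  ev (rep (sigma_even delta k n)) phi (window n p [:: x, y & l] f)
  = phi (window n (p * tperm x y)%g [:: x, y & l] f).

Definition sigma_odd_spec n := forall p x y l f phi,
  ev (rep (sigma_odd delta k n)) phi (window n p [:: x, y & l] f)
  = phi (window n (p * tperm x y)%g [:: y, x & l] f).

Section Step.
Variable n : nat.

Lemma ev_swap0 p x y l f phi : (n.+1 < k)%N ->
  ev (rep (s_ delta k n.+1)) phi (window n p [:: x, y & l] f)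
  = phi (window n p [:: y, x & l] f).
Proof. by move=> nk; have := @ev_swap_window [::] n p x y l f phi; rewrite addn0; apply. Qed.

Lemma ev_swap1 p x y z l f phi : (n.+2 < k)%N ->
  ev (rep (s_ delta k n.+2)) phi (window n p [:: x, y, z & l] f)
  = phi (window n p [:: x, z, y & l] f).
Proof. by move=> nk; have := @ev_swap_window [:: x] n p y z l f phi; rewrite addn1; apply. Qed.

Lemma ev_merge0 p x y l f phi : (n.+1 < k)%N ->
  ev (rep (e_ delta k (2 * n.+1))) phi (window n p [:: x, y & l] f)
  = if x == y then phi (window n p [:: x, y & l] f) else 0.
Proof. by move=> nk; have := @ev_merge_window [::] n p x y l f phi; rewrite addn0; apply. Qed.

Lemma ev_merge1 p x y z l f phi : (n.+2 < k)%N ->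
  ev (rep (e_ delta k (2 * n.+2))) phi (window n p [:: x, y, z & l] f)
  = if y == z then phi (window n p [:: x, y, z & l] f) else 0.
Proof. by move=> nk; have := @ev_merge_window [:: x] n p y z l f phi; rewrite addn1; apply. Qed.

Lemma ev_cut1 p x y l f phi : (n.+1 < k)%N ->
  ev (rep (e_ delta k (2 * n.+1).+1)) phi (window n p [:: x, y & l] f)
  = \sum_c phi (window n p [:: x, c & l] f).
Proof. by move=> nk; have := @ev_cut_window [:: x] n p y l f phi; rewrite addn1; apply. Qed.

Lemma sum_if_eq (G : C -> F) x : \sum_b (if b == x then G b else 0) = G x.
Proof. by rewrite -big_mkcond big_pred1_eq. Qed.

(** Let x and y be the colours of the points n and n + 1. If they are equal, all terms but
    the fourth cancel. Otherwise the two sums over b differ only at b = x, where y replaces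
    x, and this is corrected by the second and the last term of the recursion. *)
Lemma JMeven_step : (n.+1 < k)%N ->
  JMeven_spec n -> sigma_odd_spec n -> JMeven_spec n.+1.
Proof.
move=> nk evL evS p y l f phi.
rewrite (windowS _ _ _ (ltnW nk)); set x := p _.
under [RHS]eq_bigr => b _ do rewrite (windowS _ _ _ (ltnW nk)) permM -/x.
have -> : JMeven delta k n.+1 =
    s_ delta k n.+1 * JMeven delta k n * s_ delta k n.+1
    - s_ delta k n.+1 * JMeven delta k n * e_ delta k (2 * n.+1)
    - e_ delta k (2 * n.+1) * JMeven delta k n * s_ delta k n.+1
    + e_ delta k (2 * n.+1) * JMeven delta k n * e_ delta k (2 * n.+1).+1
      * e_ delta k (2 * n.+1) + sigma_odd delta k n.
  by rewrite -[(2 * n.+1).+1]addn1.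
rewrite !repD !repN !repM !evD !evN !evM evS.
set s := rep (s_ _ _ _); set e := rep (e_ _ _ (2 * _)); set c := rep (e_ _ _ _.+1).
set L := rep (JMeven _ _ _); set W := window _ _ _ _.
have -> : ev s (ev L (ev s phi)) W = \sum_b phi (window n (p * tperm y b)%g [:: x, b & l] f).
  by rewrite ev_swap0 // evL; apply: eq_bigr => b _; rewrite ev_swap0.
have -> : ev s (ev L (ev e phi)) W = phi (window n (p * tperm y x)%g [:: x, x & l] f).
  rewrite ev_swap0 // evL.
  rewrite -[RHS](sum_if_eq (fun b => phi (window n (p * tperm y b)%g [:: b, x & l] f))).
  by apply: eq_bigr => b _; rewrite ev_merge0.
have -> : ev e (ev L (ev s phi)) W
    = if x == y then \sum_b phi (window n (p * tperm x b)%g [:: x, b & l] f) else 0.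
  rewrite ev_merge0 //; case: eqP => // <-.
  by rewrite evL; apply: eq_bigr => b _; rewrite ev_swap0.
have -> : ev e (ev L (ev c (ev e phi))) W
    = if x == y then \sum_b phi (window n (p * tperm x b)%g [:: b, b & l] f) else 0.
  rewrite ev_merge0 //; case: eqP => // <-; rewrite evL; apply: eq_bigr => b _.
  rewrite ev_cut1 //.
  rewrite -[RHS](sum_if_eq (fun b' => phi (window n (p * tperm x b)%g [:: b, b' & l] f))).
  by apply: eq_bigr => b' _; rewrite ev_merge0 // eq_sym.
case: (eqVneq x y) => [<-|xy].
  under [RHS]eq_bigr => b _ do rewrite tpermL.
  by rewrite [X in X + _ + _]addrAC subrr add0r addrAC addNr add0r.
rewrite subr0 addr0 [tperm x y]tpermC [in LHS](bigD1 x) //= [in RHS](bigD1 x) //= tpermR.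
rewrite [X in X - _]addrC addrK addrC; congr (_ + _).
by apply: eq_bigr => b bx; rewrite tpermD // eq_sym.
Qed.

(** Again the sums differ only at b = x when x and y are distinct; there L_{2i} e_{2i} and
    sigma_{2i} provide the difference, and the next two terms vanish. *)
Lemma JModd_step : (n.+1 < k)%N ->
  JModd_spec n -> JMeven_spec n -> sigma_even_spec n -> JModd_spec n.+1.
Proof.
move=> nk evL' evL evS p y l f phi.
under eq_bigr => b _ do rewrite !(windowS _ _ _ (ltnW nk)) permM.
rewrite (windowS _ _ _ (ltnW nk)); set x := p _.
have -> : JModd delta k n.+1 =
    s_ delta k n.+1 * JModd delta k n * s_ delta k n.+1
    - JMeven delta k n * e_ delta k (2 * n.+1) - e_ delta k (2 * n.+1) * JMeven delta k n
    + (delta%:A - JModd delta k n) * e_ delta k (2 * n.+1) + sigma_even delta k n by [].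
rewrite !(repD, repN, repM) repZ rep1 !(evD, evN, evM) evZ ev1 evS.
set s := rep (s_ _ _ _); set e := rep (e_ _ _ (2 * _)).
set L := rep (JMeven _ _ _); set L' := rep (JModd _ _ _); set W := window _ _ _ _.
have -> : ev s (ev L' (ev s phi)) W
    = \sum_b (phi W - phi (window n (p * tperm y b)%g [:: x, y & l] f)).
  by rewrite ev_swap0 // evL'; apply: eq_bigr => b _; rewrite !ev_swap0.
have -> : ev L (ev e phi) W = phi (window n (p * tperm x y)%g [:: y, y & l] f).
  rewrite evL -[RHS](sum_if_eq (fun b => phi (window n (p * tperm x b)%g [:: b, y & l] f))).
  by apply: eq_bigr => b _; rewrite ev_merge0 //; case: eqP => // ->.
have -> : ev e (ev L phi) W
    = if x == y then \sum_b phi (window n (p * tperm x b)%g [:: b, y & l] f) else 0.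
  by rewrite ev_merge0 // evL.
have -> : #|{: C}|%:R * ev e phi W - ev L' (ev e phi) W
    = if x == y then \sum_b phi (window n (p * tperm x b)%g [:: x, y & l] f) else 0.
  have sum_cst (u : F) : \sum_(b : C) u = #|{: C}|%:R * u by rewrite sumr_const mulr_natl.
  rewrite evL' sumrB sum_cst subKr; case: eqP => [xy|/eqP/negbTE xy].
    by apply: eq_bigr => b _; rewrite ev_merge0 // xy eqxx.
  by apply: big1 => b _; rewrite ev_merge0 // xy.
rewrite !sumrB; case: (eqVneq x y) => [<-|xy].
  under [X in _ = _ - X]eq_bigr => b _ do rewrite tpermL.
  by ring.
rewrite [tperm x y]tpermC [X in _ - X - _ - _ + _ + _](bigD1 x) //=.
rewrite [X in _ = _ - X](bigD1 x) //= tpermR.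
under [X in _ = _ - (_ + X)]eq_bigr => b bx do rewrite tpermD // 1?eq_sym //.
by ring.
Qed.

(** Let x, y and z be the colours of the points n, n + 1 and n + 2. The first term of the
    recursion exchanges y and z in the first n colours, but not in x. This is wrong only
    if x is y or z; in each of these cases one of the two terms that are added is the
    correct value, and one of those subtracted removes the wrong one. *)
Lemma sigma_even_step : (n.+2 < k)%N ->
  JMeven_spec n -> sigma_even_spec n -> sigma_even_spec n.+1.
Proof.
move=> nk evL evS p y z l f phi.
have n1k := ltnW nk; rewrite !(windowS _ _ _ (ltnW n1k)) permM; set x := p _.
have -> : sigma_even delta k n.+1 =
    s_ delta k n.+1 * s_ delta k n.+2 * sigma_even delta k n * s_ delta k n.+2 * s_ delta k n.+1
    + e_ delta k (2 * n.+1) * JMeven delta k n * s_ delta k n.+2 * e_ delta k (2 * n.+1)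
      * s_ delta k n.+2
    + s_ delta k n.+2 * e_ delta k (2 * n.+1) * JMeven delta k n * s_ delta k n.+2
      * e_ delta k (2 * n.+1)
    - e_ delta k (2 * n.+1) * JMeven delta k n * s_ delta k n.+1
      * e_ delta k (2 * n.+2) * e_ delta k (2 * n.+1).+1 * e_ delta k (2 * n.+1)
    - s_ delta k n.+2 * e_ delta k (2 * n.+1) * e_ delta k (2 * n.+1).+1 * e_ delta k (2 * n.+2)
      * s_ delta k n.+1 * JMeven delta k n * e_ delta k (2 * n.+1) * s_ delta k n.+2.
  have -> : (2 * n.+1 = 2 * n.+2 - 2)%N by lia.
  by have -> : ((2 * n.+2 - 2).+1 = 2 * n.+2 - 1)%N by lia.
rewrite !(repD, repN, repM) !(evD, evN, evM).
set s := rep (s_ _ _ n.+1); set s' := rep (s_ _ _ n.+2).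
set e := rep (e_ _ _ (2 * n.+1)); set e' := rep (e_ _ _ (2 * n.+2)).
set c := rep (e_ _ _ _.+1).
set L := rep (JMeven _ _ _); set S := rep (sigma_even _ _ _); set W := window _ _ _ _.
have -> : ev s (ev s' (ev S (ev s' (ev s phi)))) W
    = phi (window n (p * tperm y z)%g [:: x, y, z & l] f).
  by rewrite ev_swap0 // ev_swap1 // evS ev_swap1 // ev_swap0.
have -> : ev e (ev L (ev s' (ev e (ev s' phi)))) W
    = if x == y then phi (window n (p * tperm x z)%g [:: z, y, z & l] f) else 0.
  rewrite ev_merge0 // evL; congr (if _ then _ else _).
  rewrite -[RHS](sum_if_eq (fun b => phi (window n (p * tperm x b)%g [:: b, y, z & l] f))).
  by apply: eq_bigr => b _; rewrite ev_swap1 // ev_merge0 // ev_swap1.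
have -> : ev s' (ev e (ev L (ev s' (ev e phi)))) W
    = if x == z then phi (window n (p * tperm x y)%g [:: y, y, z & l] f) else 0.
  rewrite ev_swap1 // ev_merge0 // evL; congr (if _ then _ else _).
  rewrite -[RHS](sum_if_eq (fun b => phi (window n (p * tperm x b)%g [:: b, y, z & l] f))).
  by apply: eq_bigr => b _; rewrite ev_swap1 // ev_merge0.
have -> : ev e (ev L (ev s (ev e' (ev c (ev e phi))))) W
    = if x == y then phi (window n (p * tperm x z)%g [:: y, y, z & l] f) else 0.
  rewrite ev_merge0 // evL; congr (if _ then _ else _).
  rewrite -[RHS](sum_if_eq (fun b => phi (window n (p * tperm x b)%g [:: y, y, z & l] f))).
  apply: eq_bigr => b _; rewrite ev_swap0 // ev_merge1 // ev_cut1 //.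
  case: eqP => // _.
  rewrite -[RHS](sum_if_eq (fun c => phi (window n (p * tperm x b)%g [:: y, c, z & l] f))).
  by apply: eq_bigr => b' _; rewrite ev_merge0 // eq_sym.
have -> : ev s' (ev e (ev c (ev e' (ev s (ev L (ev e (ev s' phi))))))) W
    = if x == z then phi (window n (p * tperm y x)%g [:: x, y, x & l] f) else 0.
  rewrite ev_swap1 // ev_merge0 // ev_cut1 //; congr (if _ then _ else _).
  rewrite (bigD1 y) //= big1 ?addr0 => [|b by_]; last by rewrite ev_merge1 // (negbTE by_).
  rewrite ev_merge1 // eqxx ev_swap0 // evL.
  rewrite -[RHS](sum_if_eq (fun b => phi (window n (p * tperm y b)%g [:: b, y, x & l] f))).
  by apply: eq_bigr => b _; rewrite ev_merge0 //; case: eqP => // ->; rewrite ev_swap1.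
case: (eqVneq x y) => [<-|xy]; case: (eqVneq x z) => [<-|xz].
- rewrite tpermL; ring.
- rewrite tpermL; ring.
- rewrite tpermR [tperm x y]tpermC; ring.
- rewrite tpermD 1?eq_sym //; ring.
Qed.

(** As for [sigma_even_step], with y and z exchanged as well. *)
Lemma sigma_odd_step : (n.+2 < k)%N ->
  JMeven_spec n -> sigma_odd_spec n -> sigma_odd_spec n.+1.
Proof.
move=> nk evL evS p y z l f phi.
have n1k := ltnW nk; rewrite !(windowS _ _ _ (ltnW n1k)) permM; set x := p _.
have -> : sigma_odd delta k n.+1 =
    s_ delta k n.+1 * s_ delta k n.+2 * sigma_odd delta k n * s_ delta k n.+2 * s_ delta k n.+1
    + s_ delta k n.+2 * e_ delta k (2 * n.+1) * JMeven delta k n * s_ delta k n.+2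
      * e_ delta k (2 * n.+1) * s_ delta k n.+2
    + e_ delta k (2 * n.+1) * JMeven delta k n * s_ delta k n.+2 * e_ delta k (2 * n.+1)
    - s_ delta k n.+2 * e_ delta k (2 * n.+1) * JMeven delta k n * s_ delta k n.+1
      * e_ delta k (2 * n.+2) * e_ delta k (2 * n.+1).+1 * e_ delta k (2 * n.+1)
    - e_ delta k (2 * n.+1) * e_ delta k (2 * n.+1).+1 * e_ delta k (2 * n.+2)
      * s_ delta k n.+1 * JMeven delta k n * e_ delta k (2 * n.+1) * s_ delta k n.+2.
  have -> : (2 * n.+1 = 2 * n.+2 - 2)%N by lia.
  by have -> : ((2 * n.+2 - 2).+1 = 2 * n.+2 - 1)%N by lia.
rewrite !(repD, repN, repM) !(evD, evN, evM).
set s := rep (s_ _ _ n.+1); set s' := rep (s_ _ _ n.+2).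
set e := rep (e_ _ _ (2 * n.+1)); set e' := rep (e_ _ _ (2 * n.+2)).
set c := rep (e_ _ _ _.+1).
set L := rep (JMeven _ _ _); set S := rep (sigma_odd _ _ _); set W := window _ _ _ _.
have -> : ev s (ev s' (ev S (ev s' (ev s phi)))) W
    = phi (window n (p * tperm y z)%g [:: x, z, y & l] f).
  by rewrite ev_swap0 // ev_swap1 // evS ev_swap1 // ev_swap0.
have -> : ev s' (ev e (ev L (ev s' (ev e (ev s' phi))))) W
    = if x == z then phi (window n (p * tperm x y)%g [:: y, z, y & l] f) else 0.
  rewrite ev_swap1 // ev_merge0 // evL; congr (if _ then _ else _).
  rewrite -[RHS](sum_if_eq (fun b => phi (window n (p * tperm x b)%g [:: b, z, y & l] f))).
  by apply: eq_bigr => b _; rewrite ev_swap1 // ev_merge0 // ev_swap1.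
have -> : ev e (ev L (ev s' (ev e phi))) W
    = if x == y then phi (window n (p * tperm x z)%g [:: z, z, y & l] f) else 0.
  rewrite ev_merge0 // evL; congr (if _ then _ else _).
  rewrite -[RHS](sum_if_eq (fun b => phi (window n (p * tperm x b)%g [:: b, z, y & l] f))).
  by apply: eq_bigr => b _; rewrite ev_swap1 // ev_merge0.
have -> : ev s' (ev e (ev L (ev s (ev e' (ev c (ev e phi)))))) W
    = if x == z then phi (window n (p * tperm x y)%g [:: z, z, y & l] f) else 0.
  rewrite ev_swap1 // ev_merge0 // evL; congr (if _ then _ else _).
  rewrite -[RHS](sum_if_eq (fun b => phi (window n (p * tperm x b)%g [:: z, z, y & l] f))).
  apply: eq_bigr => b _; rewrite ev_swap0 // ev_merge1 // ev_cut1 //.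
  case: eqP => // _.
  rewrite -[RHS](sum_if_eq (fun c => phi (window n (p * tperm x b)%g [:: z, c, y & l] f))).
  by apply: eq_bigr => b' _; rewrite ev_merge0 // eq_sym.
have -> : ev e (ev c (ev e' (ev s (ev L (ev e (ev s' phi)))))) W
    = if x == y then phi (window n (p * tperm z x)%g [:: x, z, x & l] f) else 0.
  rewrite ev_merge0 // ev_cut1 //; congr (if _ then _ else _).
  rewrite (bigD1 z) //= big1 ?addr0 => [|b bz]; last by rewrite ev_merge1 // (negbTE bz).
  rewrite ev_merge1 // eqxx ev_swap0 // evL.
  rewrite -[RHS](sum_if_eq (fun b => phi (window n (p * tperm z b)%g [:: b, z, x & l] f))).
  by apply: eq_bigr => b _; rewrite ev_merge0 //; case: eqP => // ->; rewrite ev_swap1.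
case: (eqVneq x y) => [<-|xy]; case: (eqVneq x z) => [<-|xz].
- rewrite tpermL; ring.
- rewrite tpermL [tperm z x]tpermC; ring.
- rewrite tpermR [tperm x y]tpermC; ring.
- rewrite tpermD 1?eq_sym //; ring.
Qed.

End Step.

Lemma ev_JM n : (n < k)%N ->
  [/\ JModd_spec n, JMeven_spec n
    & (n.+1 < k)%N -> sigma_even_spec n /\ sigma_odd_spec n].
Proof.
elim: n => [|n IH] nk.
  split=> [p x l f phi|p x l f phi|k1].
  - rewrite rep0 ev0 big1 // => b _.
    by rewrite (window0 (p * tperm x b) p) subrr.
  - have := @ev_cut_window [::] 0 p x l f phi nk; rewrite addn0 => ->.
    by apply: eq_bigr => b _; rewrite (window0 p (p * tperm x b)).
  split=> p x y l f phi; rewrite (window0 (p * tperm x y) p).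
    by rewrite rep1 ev1.
  exact: ev_swap0.
have [L' L /(_ nk)[S S']] := IH (ltnW nk).
split=> [||n2k]; first exact: JModd_step; first exact: JMeven_step.
by split; [apply: sigma_even_step | apply: sigma_odd_step].
Qed.

End JMAction.

(** * Common eigenbases *)
Section Diagonalised.
Variables (F : fieldType) (N : nat) (P : 'M[F]_N).
Hypothesis Punit : P \in unitmx.
Implicit Types (X Y E : 'M[F]_N) (d e : 'I_N -> F).

Definition diagonalised X d : Prop := P *m X = diag_mx (\row_j d j) *m P.

Lemma eq_diagonalised X d e : d =1 e -> diagonalised X d -> diagonalised X e.
Proof.
move=> de; rewrite /diagonalised => ->; congr (diag_mx _ *m _).
by apply/rowP=> j; rewrite !mxE.
Qed.

Lemma diagonalisedZ c X d : diagonalised X d -> diagonalised (c *: X) (fun j => c * d j).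
Proof.
rewrite /diagonalised -scalemxAr => ->; rewrite scalemxAl; congr (_ *m _).
by apply/matrixP=> i j; rewrite !mxE mulrnAr.
Qed.

Lemma diagonalisedD X Y d e : diagonalised X d -> diagonalised Y e ->
  diagonalised (X + Y) (fun j => d j + e j).
Proof.
rewrite /diagonalised mulmxDr => -> ->; rewrite -mulmxDl; congr (_ *m _).
by apply/matrixP=> i j; rewrite !mxE mulrnDl.
Qed.

Lemma diagonalised0 : diagonalised 0 (fun=> 0).
Proof.
rewrite /diagonalised mulmx0 -[LHS](mul0mx _ P); congr (_ *m _).
by apply/matrixP=> i j; rewrite !mxE mul0rn.
Qed.

Lemma diagonalised1 : diagonalised 1 (fun=> 1).
Proof.
rewrite /diagonalised [P *m _]mulmx1 -[LHS](mul1mx P); congr (_ *m _).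
by apply/matrixP=> i j; rewrite !mxE.
Qed.

Lemma diagonalisedM X Y d e : diagonalised X d -> diagonalised Y e ->
  diagonalised (X * Y) (fun j => d j * e j).
Proof.
rewrite /diagonalised => dX dY; rewrite [P *m _]mulmxA dX -mulmxA dY mulmxA.
congr (_ *m _); rewrite mulmx_diag; congr diag_mx.
by apply/rowP=> j; rewrite !mxE.
Qed.

Lemma diagonalisedX m X d : diagonalised X d -> diagonalised (X ^+ m) (fun j => d j ^+ m).
Proof.
move=> dX; elim: m => [|m IH]; first exact: diagonalised1.
rewrite exprS; apply: eq_diagonalised (diagonalisedM dX IH) => j.
by rewrite exprS.
Qed.

Lemma diagonalised_sum I (s : seq I) (G : I -> 'M[F]_N) (d : I -> 'I_N -> F) :
  (forall i, diagonalised (G i) (d i)) ->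
  diagonalised (\sum_(i <- s) G i) (fun j => \sum_(i <- s) d i j).
Proof.
move=> dG; elim: s => [|i s IH].
  by rewrite big_nil; apply: eq_diagonalised diagonalised0 => j; rewrite big_nil.
rewrite big_cons; apply: eq_diagonalised (diagonalisedD (dG i) IH) => j.
by rewrite big_cons.
Qed.

Lemma diagonalised_prod I (s : seq I) (G : I -> 'M[F]_N) (d : I -> 'I_N -> F) :
  (forall i, diagonalised (G i) (d i)) ->
  diagonalised (\prod_(i <- s) G i) (fun j => \prod_(i <- s) d i j).
Proof.
move=> dG; elim: s => [|i s IH].
  by rewrite big_nil; apply: eq_diagonalised diagonalised1 => j; rewrite big_nil.
rewrite big_cons; apply: eq_diagonalised (diagonalisedM (dG i) IH) => j.
by rewrite big_cons.
Qed.

(** In the eigenbasis, the entry of the commutator at (i, j) is the entry of E multiplied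
    by d i - d j. *)
Lemma diagonalised_commP X d E : diagonalised X d ->
  (X * E = E * X <-> forall i j, (P *m E *m invmx P) i j != 0 -> d i = d j).
Proof.
move=> dX; have : P *m E = P *m E *m invmx P *m P by rewrite mulmxKV.
move: (P *m E *m invmx P) => E' PE.
have XE : (X * E = E * X) <-> (diag_mx (\row_j d j) *m E' = E' *m diag_mx (\row_j d j)).
  split=> [com|com].
    apply: (can_inj (mulmxK Punit)).
    by rewrite -!mulmxA -PE -dX !mulmxA -dX -PE -!mulmxA; congr (_ *m _).
  apply: (can_inj (mulKmx Punit)).
  by rewrite [LHS]mulmxA dX -mulmxA PE mulmxA com -mulmxA -dX mulmxA -PE -mulmxA.
apply: (iff_trans XE); rewrite mul_diag_mx mul_mx_diag; split=> [/matrixP com i j nz|com].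
  by move: (com i j); rewrite !mxE [RHS]mulrC => /(mulIf nz).
apply/matrixP=> i j; rewrite !mxE mulrC.
by have [->|/com->//] := eqVneq (E' i j) 0; rewrite !mul0r.
Qed.

End Diagonalised.

Lemma codiagonalise_real_symmetric (F : numClosedFieldType) (N : nat) (I : finType)
    (O : I -> 'M[F]_N) :
  (forall i, (O i)^T = O i) -> (forall i, O i \is a realmx) ->
  (forall i j, O i *m O j = O j *m O i) ->
  exists2 P, P \in unitmx & exists d, forall i, diagonalised P (O i) (d i).
Proof.
move=> Osym Oreal Ocomm.
have [P Punit /allP PO] : codiagonalizable [seq O i | i <- enum I].
  apply/codiagonalizableP; split=> [A B /mapP[i _ ->] /mapP[j _ ->]|A /mapP[i _ ->]].
    exact: Ocomm.
  have : O i \is normalmx.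
    apply: symmetric_normalmx => //; apply/is_hermitianmxP.
    by rewrite expr0 scale1r map_mx_id.
  move/orthomx_spectralP=> OE; exists (spectralmx (O i)); first exact: spectral_unit.
  apply/diagonalizable_forPex; exists (spectral_diag (O i)).
  apply/simmxP; first exact: spectral_unit.
  by rewrite {2}OE !mulmxA mulmxV ?spectral_unit // mul1mx.
exists P => //.
have dP i : exists D : 'rV_N, P *m O i == diag_mx D *m P.
  have /diagonalizable_forPex[D /(simmxP Punit) PD] := PO _ (map_f O (mem_enum I i)).
  by exists D; apply/eqP.
exists (fun i j => xchoose (dP i) 0 j) => i; apply: etrans (eqP (xchooseP (dP i))) _.
by congr (diag_mx _ *m _); apply/rowP=> j; rewrite mxE.
Qed.

(** * Evaluation at the Jucys-Murphy operators *)
Section JMOperators.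
Variables (F : fieldType) (k t : nat).
Local Notation C := {ffun 'I_t -> bool}.
Local Notation X := {ffun 'I_k -> C}.
Local Notation delta := (#|{: C}|%:R : F).
Local Notation op := 'M[F]_#|[the finType of X]|.
Implicit Types (f : X) (o : 'I_k) (n : nat) (p : {perm C}).

Lemma window_tail n p f :
  window n p [seq f i | i <- drop n (enum 'I_k)] f = recolour n p f.
Proof.
apply/ffunP=> i; rewrite !ffunE; case: ltnP => // ni.
rewrite (nth_map i) ?size_drop ?size_enum_ord ?ltn_sub2r ?(leq_ltn_trans ni) //.
by rewrite nth_drop subnKC // nth_ord_enum.
Qed.

Lemma tail_cons o f :
  [seq f i | i <- drop o (enum 'I_k)] = f o :: [seq f i | i <- drop o.+1 (enum 'I_k)].
Proof. by rewrite (drop_nth o) ?size_enum_ord // nth_ord_enum. Qed.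

Lemma window1 o f :
  f = window o 1%g (f o :: [seq f i | i <- drop o.+1 (enum 'I_k)]) f.
Proof. by rewrite -tail_cons window_tail recolour1. Qed.

Lemma rep_JMeven o : rep (JMeven delta k o) = jm_op F C o.+1 o :> op.
Proof.
apply: ev_inj => phi f; rewrite ev_jm_op.
have [_ JE _] := ev_JM F t (ltn_ord o).
rewrite [in LHS](window1 o f) JE; apply: eq_bigr => b _.
rewrite -window_tail (windowS _ _ _ (ltn_ord o)) mul1g.
by rewrite (_ : Ordinal _ = o) ?tpermL //; apply: val_inj.
Qed.

Lemma rep_JModd o : rep (JModd delta k o) = delta%:M - jm_op F C o o :> op.
Proof.
apply: ev_inj => phi f; rewrite evB -scalemx1 evZ ev1 ev_jm_op.
have [JO _ _] := ev_JM F t (ltn_ord o).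
rewrite [in LHS](window1 o f) JO -window1 sumrB sumr_const mulr_natl.
congr (_ - _); apply: eq_bigr => b _.
by rewrite -window_tail tail_cons mul1g.
Qed.

Lemma rep_JM (i : nat) : (i < k.*2)%N ->
  rep (JM delta k i.+1) = if odd i then jm_at F k C i else delta%:M - jm_at F k C i.
Proof.
move=> ik; have ok : (i./2 < k)%N by rewrite ltn_half_double.
pose o := Ordinal ok; rewrite (@jm_atE _ _ _ _ o) // /JM /=.
have := odd_double_half i; rewrite -[i./2]/(nat_of_ord o).
case: (odd i) => /= <-.
  by rewrite add1n /= doubleK -[i./2]/(nat_of_ord o) rep_JMeven.
by rewrite add0n uphalf_double -[i./2]/(nat_of_ord o) rep_JModd.
Qed.

End JMOperators.

Section EvaluationCommutes.
Variables (F : numClosedFieldType) (r t : nat).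
Local Notation k := (uphalf r).
Local Notation C := {ffun 'I_t -> bool}.
Local Notation X := {ffun 'I_k -> C}.
Local Notation delta := (#|{: C}|%:R : F).
Local Notation op := 'M[F]_#|[the finType of X]|.
Implicit Types (p : {mpoly F[r]}) (i j : 'I_r) (d : diagram k).

Lemma ltn_uphalf_double i : (i < k.*2)%N.
Proof. by rewrite (leq_trans (ltn_ord i)) // uphalf_half -{1}[r]odd_double_half; lia. Qed.

Lemma jm_at_op i : exists2 o : 'I_k, o = i./2 :> nat & jm_at F k C i = jm_op F C (uphalf i) o.
Proof.
have ok : (i./2 < k)%N by rewrite ltn_half_double ltn_uphalf_double.
by exists (Ordinal ok); last exact: jm_atE.
Qed.

Lemma jm_at_comm i j : jm_at F k C i * jm_at F k C j = jm_at F k C j * jm_at F k C i.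
Proof.
wlog lt_ij : i j / (i < j)%N => [W|].
  by case: (ltngtP i j) => [/W|/W->|/ord_inj->].
have [[o oi ->] [o' oj ->]] := (jm_at_op i, jm_at_op j).
by apply: jm_op_comm; rewrite ?oi ?oj; lia.
Qed.

Lemma jm_at_sym i : (jm_at F k C i)^T = jm_at F k C i.
Proof. by have [o oi ->] := jm_at_op i; rewrite jm_op_sym // oi; lia. Qed.

Lemma jm_at_real i : jm_at F k C i \is a mxOver Num.real.
Proof.
have [o _ ->] := jm_at_op i; apply/mxOverP => a b; rewrite mxE.
by apply: rpred_sum => c _; apply: realn.
Qed.

Lemma rep_normalised_JM i :
  rep (normalised_JM delta k i.+1) = (-1) ^+ i *: ((delta / 2)%:M - jm_at F k C i).
Proof.
rewrite /normalised_JM repB repZ rep1 scalemx1 (rep_JM _ _ (ltn_uphalf_double i)).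
rewrite -signr_odd; case: (odd i) => /=; rewrite ?expr1 ?scaleN1r ?opprB // expr0 scale1r.
by rewrite addrAC -raddfB /= {1}[delta]splitr addrK.
Qed.

Lemma rep_prod I (s : seq I) (G : I -> partition_algebra delta k) :
  rep (\prod_(i <- s) G i) = \prod_(i <- s) rep (G i).
Proof. exact: (big_morph (@rep F k t) (@repM F k t) (@rep1 F k t)). Qed.

Lemma rep_JM_eval p : rep (JM_eval delta p)
  = \sum_(m <- msupp p) p@_m *: \prod_(i < r) rep (normalised_JM delta k i.+1) ^+ m i.
Proof.
rewrite /JM_eval /mmap rep_sum; apply: eq_bigr => m _.
rewrite /= mulr_algl repZ rep_prod; congr (_ *: _).
by apply: eq_bigr => i _; rewrite repX.
Qed.

(** In the common eigenbasis, a nonzero entry of E joins two eigenvectors on which all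
    the alternating power sums of the eigenvalues of jm_at i - 1 agree. By
    [balanced_supersymmetric] the values of p agree on them too. *)
Lemma supersymmetric_rep_comm p (E : op) : supersymmetric p ->
  (forall m, alt_psum F k C m r * E = E * alt_psum F k C m r) ->
  rep (JM_eval delta p) * E = E * rep (JM_eval delta p).
Proof.
move=> ssp commE.
have [P Punit [d Pd]] := codiagonalise_real_symmetric jm_at_sym jm_at_real jm_at_comm.
pose y a := [ffun i => d i a - 1]; pose z a := [ffun i => delta / 2 - d i a].
have dscal c : diagonalised P c%:M (fun=> c).
  rewrite -scalemx1; apply: eq_diagonalised (diagonalisedZ c (diagonalised1 P)) => a.
  by rewrite mulr1.
have dB M M' e e' : diagonalised P M e -> diagonalised P M' e' ->
    diagonalised P (M - M') (fun a => e a - e' a).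
  move=> dM dM'; rewrite -scaleN1r.
  by apply: eq_diagonalised (diagonalisedD dM (diagonalisedZ (-1) dM')) => a; rewrite mulN1r.
have eval : diagonalised P (rep (JM_eval delta p)) (fun a => p.@[signed (z a)]).
  have dN i : diagonalised P (rep (normalised_JM delta k i.+1)) (fun a => signed (z a) i).
    rewrite rep_normalised_JM.
    apply: eq_diagonalised (diagonalisedZ ((-1) ^+ i) (dB _ _ _ _ (dscal (delta / 2)) (Pd i))) => a.
    by rewrite /signed ffunE.
  have dX (m : 'X_{1..r}) : diagonalised P
      (p@_m *: \prod_(i < r) rep (normalised_JM delta k i.+1) ^+ m i)
      (fun a => p@_m * \prod_(i < r) signed (z a) i ^+ m i).
    by apply/diagonalisedZ/diagonalised_prod => i; apply: diagonalisedX.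
  rewrite rep_JM_eval; apply: eq_diagonalised (diagonalised_sum (msupp p) dX) => a.
  by rewrite mevalE.
have psum m : diagonalised P (alt_psum F k C m r) (fun a => \sum_(i < r) (-1) ^+ i * y a i ^+ m).
  apply: diagonalised_sum => i; apply: diagonalisedZ; apply: diagonalisedX.
  by apply: eq_diagonalised (dB _ _ _ _ (Pd i) (diagonalised1 P)) => a; rewrite ffunE.
apply/(diagonalised_commP Punit E eval) => a b ab.
apply: balanced_supersymmetric => // h.
have y_ab : balanced (y a) (y b).
  apply: balanced_pow => m.
  exact: ((diagonalised_commP Punit E (psum m)).1 (commE m) a b ab).
have zE c i : z c i = delta / 2 - 1 - y c i by rewrite !ffunE; ring.
have := y_ab (fun u => h (delta / 2 - 1 - u)).
by under eq_bigr => i _ do rewrite -zE; under [RHS]eq_bigr => i _ do rewrite -zE.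
Qed.

End EvaluationCommutes.

(** * Faithfulness of the action *)
Section LocalOperators.
Variables (F : fieldType) (k : nat) (C : finType) (o : 'I_k).
Local Notation X := {ffun 'I_k -> C}.
Local Notation op := 'M[F]_#|[the finType of X]|.
Implicit Types (E : op).

Lemma local_at0 : local_at o (0 : op).
Proof. by move=> phi psi f _; rewrite !ev0. Qed.

Lemma local_at1 : local_at o (1 : op).
Proof. by move=> phi psi f e; rewrite !ev1 e. Qed.

Lemma local_atD E E' : local_at o E -> local_at o E' -> local_at o (E + E').
Proof. by move=> lE lE' phi psi f e; rewrite !evD (lE phi psi) // (lE' phi psi). Qed.

Lemma local_atZ (c : F) E : local_at o E -> local_at o (c *: E).
Proof. by move=> lE phi psi f e; rewrite !evZ (lE phi psi). Qed.

Lemma local_atM E E' : local_at o E -> local_at o E' -> local_at o (E * E').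
Proof.
move=> lE lE' phi psi f e; rewrite !evM; apply: lE => g gf; apply: lE' => h hg.
by apply: e; rewrite hg.
Qed.

Lemma local_atX E m : local_at o E -> local_at o (E ^+ m).
Proof.
by move=> lE; elim: m => [|m IH]; rewrite ?exprS; [apply: local_at1|apply: local_atM].
Qed.

End LocalOperators.

Section DiagramOperators.
Variables (F : fieldType) (k t : nat).
Local Notation C := {ffun 'I_t -> bool}.
Local Notation X := {ffun 'I_k -> C}.
Local Notation delta := (#|{: C}|%:R : F).
Local Notation A := (partition_algebra delta k).
Implicit Types (d : diagram k) (x : A) (f g : X).

Lemma rep_dg_equivariant d : equivariant k (rep (dg d : A)).
Proof.
move=> p; apply: ev_inj => phi f; rewrite !evM ev_pullback !ev_dg.
rewrite (reindex_inj (h := recolour k p)) /=.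
  by apply: eq_big => [g|g _]; rewrite ?respects_recolour ?ev_pullback.
move=> g h /ffunP e; apply/ffunP=> i; have := e i.
by rewrite !ffunE ltn_ord => /perm_inj.
Qed.

Lemma rep_dg_local d (o : 'I_k) : same_block d (inl o) (inr o) -> local_at o (rep (dg d : A)).
Proof.
move=> d_o phi psi f e; rewrite !ev_dg; apply: eq_bigr => g /respectsP/(_ _ _ d_o)/=.
by move=> fg; apply: e.
Qed.

Definition refines d' d : bool := [forall u, forall v, same_block d' u v ==> same_block d u v].

Lemma refinesP d' d :
  reflect (forall u v, same_block d' u v -> same_block d u v) (refines d' d).
Proof.
apply: (iffP idP) => [H u v|H].
  by move/forallP/(_ u)/forallP/(_ v)/implyP: H.
by apply/forallP=> u; apply/forallP=> v; apply/implyP; apply: H.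
Qed.

Lemma generic_colouring d : (k.*2 <= t)%N ->
  exists f g : X, forall u v, (vcolour f g u == vcolour f g v) = same_block d u v.
Proof.
move=> kt; have card_le : (#|{: {set vertex k}}| <= #|{: C}|)%N.
  rewrite -cardsT -powersetT card_powerset cardsT card_ffun card_bool card_sum !card_ord addnn.
  by rewrite leq_exp2l.
pose iota (B : {set vertex k}) : C := enum_val (widen_ord card_le (enum_rank B)).
have iota_inj : injective iota.
  by move=> B B' /enum_val_inj/(congr1 val)/= /ord_inj/enum_rank_inj.
pose blk u := [set w | same_block d u w].
exists [ffun i => iota (blk (inl i))], [ffun i => iota (blk (inr i))] => u v.
have cE w : vcolour [ffun i => iota (blk (inl i))] [ffun i => iota (blk (inr i))] w
            = iota (blk w) by case: w => i /=; rewrite ffunE.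
have [re sy tr] := same_blockE d.
rewrite !cE (inj_eq iota_inj); apply/eqP/idP=> [/setP/(_ v)|uv].
  by rewrite !inE re.
apply/setP=> w; rewrite !inE; apply/idP/idP; last exact: tr.
by apply: tr; rewrite sy.
Qed.

(** At a pair (f, g) whose colours distinguish exactly the blocks of d, the matrix of x
    has as entry the sum of the coefficients of all refinements of d. These sums
    determine the coefficients, by induction from the finest diagrams upwards. *)
Lemma coef_eq0 (D : pred (diagram k)) x : (k.*2 <= t)%N ->
  (forall d d', D d -> refines d' d -> D d') ->
  (forall d f g, D d -> (forall u v, (vcolour f g u == vcolour f g v) = same_block d u v) ->
     ev (rep x) (fun h => (h == g)%:R) f = 0) ->
  forall d, D d -> x d = 0.
Proof.
move=> kt Ddown x0 d; pose size d := #|[set uv | same_block d uv.1 uv.2]|.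
have [n] := ubnP (size d); elim: n d => // n IH d; rewrite ltnS => dn Dd.
have [f [g fgE]] := generic_colouring d kt.
have respE d' : respects d' f g = refines d' d.
  apply/respectsP/refinesP=> H u v /H; first by rewrite -fgE => ->.
  by rewrite -fgE => /eqP.
have := x0 _ _ _ Dd fgE; rewrite ev_rep (bigD1 g) //= eqxx mulr1.
rewrite [X in _ + X]big1 ?addr0 => [|h /negbTE->]; last by rewrite mulr0.
rewrite (bigD1 d) //= respE [refines d d](_ : _ = true) ?mulr1; last exact/refinesP.
rewrite big1 ?addr0 // => d' d'd; rewrite respE.
have [rd'|] := boolP (refines d' d); last by rewrite mulr0.
rewrite (IH d') ?mul0r //; last exact: Ddown rd'.
apply: leq_trans dn; apply/proper_card; rewrite properE; apply/andP; split.
  by apply/subsetP=> uv; rewrite !inE; apply/refinesP.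
apply: contra d'd => /subsetP sub; apply/eqP/diagramP => u v; apply/idP/idP.
  exact/refinesP.
by move: (sub (u, v)); rewrite !inE.
Qed.

End DiagramOperators.

(** * Coefficients as polynomials in the parameter *)
Section PolynomialFamilies.
Variables (F : fieldType) (k : nat).
Local Notation A delta := (partition_algebra (delta : F) k).
Implicit Types (x y : forall delta : F, A delta).

Definition polynomial_family x : Prop :=
  exists q : diagram k -> {poly F}, forall delta d, x delta d = (q d).[delta].

Lemma polynomial_cst (c : diagram k -> F) x :
  (forall delta d, x delta d = c d) -> polynomial_family x.
Proof. by move=> xc; exists (fun d => (c d)%:P) => delta d; rewrite hornerC xc. Qed.

Lemma polynomial0 : polynomial_family (fun delta => 0).
Proof. by apply: (@polynomial_cst (fun=> 0)) => delta d; rewrite ffunE. Qed.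

Lemma polynomial_dg d : polynomial_family (fun delta => dg d).
Proof. by apply: (@polynomial_cst (fun d' => (d' == d)%:R)) => delta d'; apply: dg_coef. Qed.

Lemma polynomial1 : polynomial_family (fun delta => 1).
Proof. exact: polynomial_dg. Qed.

Lemma polynomialD x y : polynomial_family x -> polynomial_family y ->
  polynomial_family (fun delta => x delta + y delta).
Proof.
move=> [q qE] [q' qE']; exists (fun d => q d + q' d) => delta d.
by rewrite ffunE qE qE' hornerD.
Qed.

Lemma polynomialZ (c : {poly F}) x : polynomial_family x ->
  polynomial_family (fun delta => c.[delta] *: x delta).
Proof.
move=> [q qE]; exists (fun d => c * q d) => delta d.
by rewrite ffunE qE hornerM.
Qed.

Lemma polynomialN x : polynomial_family x -> polynomial_family (fun delta => - x delta).
Proof.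
by move=> [q qE]; exists (fun d => - q d) => delta d; rewrite ffunE qE hornerN.
Qed.

Lemma polynomialB x y : polynomial_family x -> polynomial_family y ->
  polynomial_family (fun delta => x delta - y delta).
Proof. by move=> px py; apply/polynomialD/polynomialN. Qed.

Lemma polynomialM x y : polynomial_family x -> polynomial_family y ->
  polynomial_family (fun delta => x delta * y delta).
Proof.
move=> [q qE] [q' qE'].
exists (fun d => \sum_a \sum_b q a * q' b * 'X^(loops a b) * (d == Defs.comp a b)%:R%:P).
move=> delta d; rewrite -[x delta * y delta]/(pa_mul (x delta) (y delta)) pa_mul.unlock.
rewrite sum_ffunE horner_sum; apply: eq_bigr => a _.
rewrite sum_ffunE horner_sum; apply: eq_bigr => b _.
by rewrite ffunE dg_coef qE qE' !hornerM hornerXn hornerC.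
Qed.

Lemma polynomialX m x : polynomial_family x -> polynomial_family (fun delta => x delta ^+ m).
Proof.
move=> px; elim: m => [|m [q qE]]; first exact: polynomial1.
have [q' qE'] := polynomialM px (ex_intro _ q qE).
by exists q' => delta d; rewrite exprS qE'.
Qed.

Lemma polynomial_sum I (s : seq I) (G : I -> forall delta : F, A delta) :
  (forall i, polynomial_family (G i)) ->
  polynomial_family (fun delta => \sum_(i <- s) G i delta).
Proof.
move=> pG; elim: s => [|i s IH].
  by have [q qE] := polynomial0; exists q => delta d; rewrite big_nil.
have [q qE] := polynomialD (pG i) IH.
by exists q => delta d; rewrite big_cons qE.
Qed.

Lemma polynomial_prod I (s : seq I) (G : I -> forall delta : F, A delta) :
  (forall i, polynomial_family (G i)) ->
  polynomial_family (fun delta => \prod_(i <- s) G i delta).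
Proof.
move=> pG; elim: s => [|i s IH].
  by have [q qE] := polynomial1; exists q => delta d; rewrite big_nil.
have [q qE] := polynomialM (pG i) IH.
by exists q => delta d; rewrite big_cons qE.
Qed.

Lemma polynomial_scalar (c : {poly F}) : polynomial_family (fun delta => c.[delta]%:A).
Proof. exact/polynomialZ/polynomial1. Qed.

Lemma polynomial_s i : polynomial_family (fun delta => s_ delta k i).
Proof. exact: polynomial_dg. Qed.

Lemma polynomial_e n : polynomial_family (fun delta => e_ delta k n).
Proof. exact: polynomial_dg. Qed.

Lemma polynomial_JMfix n :
  [/\ polynomial_family (fun delta => JModd delta k n),
      polynomial_family (fun delta => JMeven delta k n),
      polynomial_family (fun delta => sigma_even delta k n)
    & polynomial_family (fun delta => sigma_odd delta k n)].
Proof.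
have pd : polynomial_family (fun delta => delta%:A).
  by have [q qE] := polynomial_scalar 'X; exists q => delta d; rewrite -qE hornerX.
elim: n => [|n [L' L S S']].
  split; [exact: polynomial0|exact: polynomial_e|exact: polynomial1|exact: polynomial_s].
by split; repeat first [assumption | exact: polynomial_s | exact: polynomial_e
  | exact: pd | apply: polynomialM | apply: polynomialB | apply: polynomialD].
Qed.

End PolynomialFamilies.

Lemma polynomial_family_eq0 (F : numFieldType) (k T : nat)
    (x : forall delta : F, partition_algebra delta k) d :
  polynomial_family x ->
  (forall t, (T <= t)%N -> x #|{: {ffun 'I_t -> bool}}|%:R d = 0) ->
  forall delta, x delta d = 0.
Proof.
move=> [q qE] x0 delta; rewrite qE; have [->|q0] := eqVneq (q d) 0; first by rewrite horner0.
pose pts := [seq (2 ^ (T + i))%:R : F | i <- iota 0 (size (q d))].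
have: (size pts < size (q d))%N.
  apply: max_poly_roots => //.
    apply/allP=> _ /mapP[i _ ->]; have := x0 (T + i)%N (leq_addr _ _).
    by rewrite qE card_ffun card_bool card_ord => /rootP.
  rewrite map_inj_uniq ?iota_uniq // => i j /eqP.
  by rewrite eqr_nat eqn_exp2l // eqn_add2l => /eqP.
by rewrite size_map size_iota ltnn.
Qed.

(** * Centrality *)
Section Centre.
Variables (F : numClosedFieldType) (r : nat).
Local Notation k := (uphalf r).
Implicit Types (p : {mpoly F[r]}) (delta : F).

Lemma polynomial_JM_eval p : polynomial_family (fun delta => JM_eval delta p).
Proof.
have pJM n : polynomial_family (fun delta : F => JM delta k n).
  by rewrite /JM; case: (odd n);
    [have [] := polynomial_JMfix F k n./2 | have [] := polynomial_JMfix F k n./2.-1].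
have pN n : polynomial_family (fun delta : F => normalised_JM delta k n).
  apply: polynomialB => //; have [q qE] := polynomial_scalar k ((2^-1)%:P * 'X : {poly F}).
  by exists q => delta d; rewrite -qE hornerM hornerC hornerX mulrC.
have pE := polynomial_sum (msupp p) (fun m => polynomialM
  (polynomial_scalar k (p@_m)%:P)
  (polynomial_prod (index_enum _) (fun i : 'I_r => polynomialX (m i) (pN i.+1)))).
have [q qE] := pE; exists q => delta d; rewrite -qE; congr (fun_of_fin _ d).
by apply: eq_bigr => m _; rewrite hornerC.
Qed.

Lemma rep_JM_eval_local t p (o : 'I_k) : odd r -> o.+1 = k ->
  local_at o (rep (JM_eval #|{: {ffun 'I_t -> bool}}|%:R p)).
Proof.
move=> r_odd ok; rewrite rep_JM_eval.
elim: (msupp p) => [|m s IH]; rewrite ?big_nil ?big_cons; first exact: local_at0.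
apply: local_atD IH; apply: local_atZ.
elim: (index_enum _) => [|i s' IH]; rewrite ?big_nil ?big_cons; first exact: local_at1.
apply: local_atM IH; apply: local_atX; rewrite rep_normalised_JM.
apply: local_atZ; apply: local_atD.
  by rewrite -scalemx1; apply/local_atZ/local_at1.
rewrite -scaleN1r; apply: local_atZ.
have [o' _ ->] := jm_at_op F t i; apply: jm_op_local.
by have := ltn_ord i; have := odd_double_half r; rewrite r_odd; lia.
Qed.

Lemma joins_lastE : odd r ->
  exists2 o : 'I_k, o.+1 = k & forall d, joins_last d = same_block d (inl o) (inr o).
Proof.
move=> r_odd; have r0 : (0 < r)%N by case: (r) r_odd.
have ok : (k.-1 < k)%N by rewrite prednK // uphalf_gt0.
pose o := Ordinal ok; have oE : o.+1 = k by rewrite /= prednK // uphalf_gt0.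
exists o => // d; apply/forallP/idP=> [/(_ o)|H i]; first by rewrite /vnum oE eqxx.
apply/implyP; rewrite /vnum => /eqP ik; rewrite (_ : i = o) //.
by apply: val_inj; apply: succn_inj; apply: etrans ik (esym oE).
Qed.

(** For odd r, the operators of L_1, ..., L_r preserve the colour of the last point. So
    the matrix vanishes at the colourings that are generic for a diagram whose block of
    the last top vertex misses the last bottom one; refinement keeps this property. *)
Lemma JM_eval_coef p delta d : odd r -> ~~ joins_last d -> JM_eval delta p d = 0.
Proof.
move=> r_odd nd; move: delta; apply: (@polynomial_family_eq0 _ _ k.*2 _ _ (polynomial_JM_eval p)).
have [o oE jE] := joins_lastE r_odd.
move=> t kt; move: d nd; apply: (coef_eq0 (D := fun d => ~~ joins_last d) kt) => d.
  move=> d' dj /refinesP dd'; rewrite jE; apply: contra dj; rewrite jE; exact: dd'.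
move=> f g dj fgE; rewrite (@rep_JM_eval_local t p o r_odd oE _ (fun=> 0)).
  by rewrite [LHS]big1 // => h _; rewrite mulr0.
move=> h ho; case: eqP => // hg; case/negP: dj; rewrite jE -fgE /= -hg ho eqxx //.
Qed.

Lemma rep_commutes t p d : supersymmetric p -> odd r ==> joins_last d ->
  let x := JM_eval #|{: {ffun 'I_t -> bool}}|%:R p in rep x * rep (dg d) = rep (dg d) * rep x.
Proof.
move=> ssp dj x; apply: supersymmetric_rep_comm => // m.
have eqd := @rep_dg_equivariant F k t d.
have [r_odd|r_even] := boolP (odd r); last first.
  have rk : r = k.*2 by rewrite uphalf_half (negbTE r_even) even_halfK.
  have -> : alt_psum F k {ffun 'I_t -> bool} m r = alt_psum F k {ffun 'I_t -> bool} m k.*2.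
    by congr (alt_psum F k _ m _).
  exact: alt_psum_even_comm.
have [o oE jE] := joins_lastE r_odd.
have ro : r = o.*2.+1.
  have kE : k = r./2.+1 by rewrite uphalf_half r_odd.
  by rewrite (succn_inj (etrans oE kE)) -{1}[r]odd_double_half r_odd.
have -> : alt_psum F k {ffun 'I_t -> bool} m r = alt_psum F k {ffun 'I_t -> bool} m o.*2.+1.
  by congr (alt_psum F k _ m _).
apply: alt_psum_odd_comm => //; apply: rep_dg_local.
by move: dj; rewrite r_odd jE.
Qed.

Lemma JM_eval_comm p delta d : supersymmetric p -> odd r ==> joins_last d ->
  JM_eval delta p * dg d = dg d * JM_eval delta p.
Proof.
move=> ssp dj; apply/eqP; rewrite -subr_eq0; apply/eqP/ffunP=> d'; rewrite [RHS]ffunE.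
move: delta; have px := polynomial_JM_eval p; have pd := polynomial_dg F d.
apply: (@polynomial_family_eq0 _ _ k.*2 _ _ (polynomialB (polynomialM px pd) (polynomialM pd px))).
move=> t kt; apply: (coef_eq0 (D := predT) kt) => // d'' f g _ _.
by rewrite repB !repM rep_commutes // subrr ev0.
Qed.

Lemma supersymmetric_central p delta : supersymmetric p ->
  JM_eval delta p \in 'Z(pa_sub delta r)%VS.
Proof.
move=> ssp; rewrite memv_cap; apply/andP; split.
  rewrite [JM_eval _ _]dgE; apply: rpred_sum => d _.
  have [dj|] := boolP (odd r ==> joins_last d); first by rewrite memvZ // mem_pa_sub.
  by rewrite negb_imply => /andP[ro nd]; rewrite JM_eval_coef // scale0r mem0v.
rewrite -subv_cent1; apply/span_subvP=> _ /mapP[d + ->]; rewrite mem_enum => dj.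
by apply/cent1vP/esym/JM_eval_comm.
Qed.

End Centre.

Unset Implicit Arguments.

Theorem theorem3p2p6 (R : realType) (r : nat) (delta : R[i]) (p : {mpoly R[i][r]})
    (hp : supersymmetric p) :
  JM_eval delta p \in 'Z(pa_sub delta r)%VS.
Proof. exact: supersymmetric_central. Qed.
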